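(* Let $\mathcal{A}$ be a class of graphs that is closed under taking subgraphs. If every countable graph in $\mathcal{A}$ has a well-balanced orientation, then every graph in $\mathcal{A}$ has a well-balanced orientation.
   Context: Graphs may have parallel edges (possibly infinitely many) but no loops, and may have arbitrarily many vertices and edges; a graph is countable if it has countably many vertices and edges. For distinct vertices $x,y$ of $G$, $\lambda_G(x,y)$ is the cardinal maximum number of pairwise edge-disjoint $x$–$y$ paths in $G$. For an orientation $\vec G$ of $G$ (a choice of direction for each edge), $\vec\lambda_G(x,y)$ is the maximum cardinal number of pairwise edge-disjoint directed $x$–$y$ paths in $\vec G$. The orientation is well-balanced if for all distinct vertices $x,y$: $\vec\lambda_G(x,y)\ge\lfloor\lambda_G(x,y)/2\rfloor$ if $\lambda_G(x,y)$ is finite, and $\vec\lambda_G(x,y)\ge\lambda_G(x,y)$ if $\lambda_G(x,y)$ is infinite. *)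

(* Defs.v *)
From mathcomp Require Import all_boot all_classical.
From Stdlib Require List.

Set Implicit Arguments.
Unset Strict Implicit.
Unset Printing Implicit Defensive.

Local Open Scope classical_set_scope.
Local Open Scope card_scope.

(* Loopless multigraphs whose vertices and edges are drawn from ambient types
   [V] and [E].  The values of [ends] outside [edges] are irrelevant. *)
Record graph (V E : Type) := Graph {
  vertices : set V;
  edges : set E;
  ends : E -> set V;
  endsP : forall e, edges e -> exists u v,
    [/\ vertices u, vertices v, u <> v & ends e = [set u; v]]
}.

Definition subgraph (V E : Type) (H G : graph V E) : Prop :=
  [/\ vertices H `<=` vertices G, edges H `<=` edges G &
      forall e, edges H e -> ends H e = ends G e].

Definition countable_graph (V E : Type) (G : graph V E) : Prop :=
  countable (vertices G) /\ countable (edges G).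

(* A step relation [s e u v] says that the edge [e] may be traversed from [u]
   to [v].  Paths are defined over an arbitrary step relation: [link G] yields
   the paths of [G], an orientation of [G] yields the directed paths. *)
Definition step (V E : Type) := E -> V -> V -> Prop.

Definition link (V E : Type) (G : graph V E) : step V E :=
  fun e u v => edges G e /\ ends G e = [set u; v].

(* The walk x, e_1, v_1, ..., e_n, v_n is encoded by its starting vertex x and
   the sequence (e_1, v_1), ..., (e_n, v_n). *)
Fixpoint walk (V E : Type) (s : step V E) (x : V) (p : seq (E * V)) (y : V)
    : Prop :=
  if p is (e, v) :: p' then s e x v /\ walk s v p' y else x = y.

Definition is_path (V E : Type) (s : step V E) (x y : V) (p : seq (E * V))
    : Prop :=
  walk s x p y /\ List.NoDup (x :: map snd p).

Definition edge_disjoint (V E : Type) (p q : seq (E * V)) : Prop :=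
  forall e, ~ (List.In e (map fst p) /\ List.In e (map fst q)).

Definition edge_disjoint_paths (V E : Type) (s : step V E) (x y : V)
    (P : set (seq (E * V))) : Prop :=
  (forall p, P p -> is_path s x y p) /\
  (forall p q, P p -> P q -> p <> q -> edge_disjoint p q).

Definition maximum_edge_disjoint_paths (V E : Type) (s : step V E) (x y : V)
    (P : set (seq (E * V))) : Prop :=
  edge_disjoint_paths s x y P /\
  forall Q, edge_disjoint_paths s x y Q -> Q #<= P.

(* The cardinal lambda(x, y) is represented by a set of that cardinality, namely
   a chosen edge-disjoint family of maximum cardinality; it exists for all
   distinct x and y, see [lambdaP]. *)
Definition lambda (V E : Type) (s : step V E) (x y : V) : set (seq (E * V)) :=
  xget set0 (maximum_edge_disjoint_paths s x y).

Definition orientation (V E : Type) (G : graph V E) (o : step V E) : Prop :=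
  (forall e u v, o e u v -> link G e u v) /\
  (forall e u v, link G e u v ->
     (o e u v /\ ~ o e v u) \/ (o e v u /\ ~ o e u v)).

Definition well_balanced (V E : Type) (G : graph V E) (o : step V E) : Prop :=
  forall x y, vertices G x -> vertices G y -> x <> y ->
    (forall n, lambda (link G) x y #= `I_n -> `I_(n./2) #<= lambda o x y) /\
    (infinite_set (lambda (link G) x y) ->
       lambda (link G) x y #<= lambda o x y).

Definition has_well_balanced_orientation (V E : Type) (G : graph V E) : Prop :=
  exists o : step V E, orientation G o /\ well_balanced G o.

Lemma card_leX_nat (T : Type) (A : set T) :
  infinite_set A -> A `*` [set: nat] #<= A.
Proof.
elim/Ppointed: T => T in A *.
  by rewrite [A]empty_eq0 => /(_ (finite_set0 _)).
move=> Ainf.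
pose P (S : set (nat -> T)) :=
  (forall g, S g -> injective g /\ forall n, A (g n)) /\
  (forall g h m n, S g -> S h -> g m = h n -> g = h).
have [F FP Ftot|S [[SA Sdis] Smax]] := @Zorn_bigcup _ P.
  split=> [g [X FX Xg]|g h m n [X FX Xg] [Y FY Yh]].
    exact: (FP _ FX).1.
  have [XY|YX] := Ftot _ _ FX FY.
    by apply: (FP _ FY).2 => //; exact: XY.
  by apply: (FP _ FX).2 => //; exact: YX.
pose L := A `\` [set t | exists g n, S g /\ g n = t].
have Lfin : finite_set L.
  apply: contrapT => /infiniteP/pcard_leP[f].
  have fL n : L (f n) by exact: (@funS _ _ setT L f).
  have finj : injective f.
    by move=> m n; apply: (@inj _ _ setT f); rewrite inE.
  apply: (Smax (S `|` [set (f : nat -> T)])).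
    split; first by move=> g; left.
    move=> /(_ f (or_intror erefl)) Sf.
    by have [_] := fL 0; apply; exists f, 0.
  split=> [g [/SA//|->]|g h m n].
    by split=> // n; exact: (fL n).1.
  case=> [Sg|->] [Sh|->] //; first exact: Sdis.
    by move=> e; case: (fL n).2; exists g, m.
  by move=> e; case: (fL m).2; exists h, n.
have [g0 Sg0] : S !=set0.
  apply/set0P/negP => /eqP S0; apply: Ainf; apply: sub_finite_set Lfin.
  by move=> t At; split=> // -[g [n []]]; rewrite S0.
have [l Ll] : exists l : nat -> T, L `<=` range l.
  have /pcard_injP[f finj] := finite_set_countable Lfin.
  exists (fun n => xget point [set t | L t /\ f t = n]) => t Lt.
  exists (f t) => //; case: xgetP => [u _ [Lu fu]|/(_ t)[]//].
  by apply: finj => //; rewrite inE.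
have SAle : S `*` [set: nat] #<= A.
  apply/pcard_leP/injfunPex; exists (fun u => u.1 u.2).
    by move=> [g n] [/= /SA[_ ]].
  move=> [g m] [h n]; rewrite !inE => -[/= Sg _] [/= Sh _] e.
  have gh := Sdis _ _ _ _ Sg Sh e; rewrite -{}gh in e *.
  by rewrite ((SA _ Sg).1 _ _ e).
apply: card_le_trans SAle.
pose h (g : nat -> T) n := if odd n then l n./2 else g n./2.
have unpick n m : exists k, (unpickle k : option (nat * nat)) = Some (n, m).
  by exists (pickle (n, m)); rewrite pickleK.
pose F (u : (nat -> T) * nat) :=
  if (unpickle u.2 : option (nat * nat)) is Some (n, m) then (h u.1 n, m)
  else (point, 0).
apply: card_le_trans (card_image_le F _); apply: subset_card_le.
move=> [t m] [/= At _].
have [[g [n [Sg gn]]]|NS] := pselect (exists g n, S g /\ g n = t).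
  have [k kE] := unpick n.*2 m.
  by exists (g, k) => //; rewrite /F /= kE /h odd_double doubleK gn.
have [n _ ln] : range l t by apply: Ll.
have [k kE] := unpick n.*2.+1 m.
by exists (g0, k) => //; rewrite /F /= kE /h /= odd_double /= uphalf_double ln.
Qed.

Lemma maximum_edge_disjoint_paths_exists (V E : Type) (s : step V E) (x y : V) :
  x <> y -> exists P, maximum_edge_disjoint_paths s x y P.
Proof.
move=> xy.
have pathN0 p : is_path s x y p -> exists e, List.In e (map fst p).
  by case: p => [[/xy]//|[e v] p _]; exists e; left.
have [F FP Ftot|M [[Mp Mdis] Mmax]] :=
    @Zorn_bigcup _ (edge_disjoint_paths s x y).
  split=> [p [X FX Xp]|p q [X FX Xp] [Y FY Yq]]; first exact: (FP _ FX).1.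
  have [XY|YX] := Ftot _ _ FX FY.
    by apply: (FP _ FY).2 => //; exact: XY.
  by apply: (FP _ FX).2 => //; exact: YX.
have meet q : is_path s x y q ->
    exists p e, [/\ M p, List.In e (map fst p) & List.In e (map fst q)].
  move=> qp; apply: contrapT => no.
  have Mq : ~ M q.
    by move=> Mq; have [e eq] := pathN0 _ qp; apply: no; exists q, e.
  apply: (Mmax (M `|` [set q])).
    split; first by move=> p; left.
    by move=> /(_ q (or_intror erefl)).
  split=> [p [/Mp//|->//]|p r [Mpp|->] [Mr|->]] //.
  - exact: Mdis.
  - by move=> _ e [ep eq]; apply: no; exists p, e.
  - by move=> _ e [eq er]; apply: no; exists r, e.
pose f (Q : set (seq (E * V))) (u : seq (E * V) * nat) : seq (E * V) :=
  @xget {classic seq (E * V)} [::] [set q : seq (E * V) | Q q /\ exists2 e,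
    List.nth_error (map fst u.1) u.2 = Some e & List.In e (map fst q)].
have cover Q : edge_disjoint_paths s x y Q ->
    Q `<=` f Q @` [set u | M u.1 /\ u.2 < size u.1].
  move=> [Qp Qdis] q Qq.
  have [p [e [Mpp ep eq]]] := meet _ (Qp _ Qq).
  have [i ie] := List.In_nth_error _ _ ep.
  exists (p, i) => /=.
    split=> //; rewrite -(size_map fst).
    by apply/ssrnat.ltP/List.nth_error_Some; rewrite ie.
  rewrite /f; case: xgetP => [r _ [Qr [e' /=]]|/(_ q)]; last first.
    by case; split=> //; exists e.
  rewrite ie => -[<-] er; apply: contrapT => rq.
  exact: (Qdis _ _ Qr Qq rq e).
have [Mfin|Minf] := pselect (finite_set M); last first.
  exists M; split=> // Q Qd.
  apply: card_le_trans (card_leX_nat Minf).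
  apply: card_le_trans (card_image_le (f Q) _); apply: subset_card_le.
  by move=> q /(cover _ Qd)[u [Mu _] uq]; exists u.
have [N NP] : exists N, forall Q, edge_disjoint_paths s x y Q -> Q #<= `I_N.
  have [K KP] : exists K, forall p, M p -> size p < K.
    have [K KP] : exists K, forall n, (size @` M) n -> n < K.
      have /finite_seqP[A ->] := finite_image (@size _) Mfin.
      exists (\max_(i <- A) i).+1 => n /= nA.
      by rewrite ltnS; exact: leq_bigmax_seq.
    by exists K => p Mpp; apply: KP; exists p.
  have [N NE] := finite_setX Mfin (finite_II K).
  exists N => Q Qd; rewrite -(card_le_eqr NE).
  apply: card_le_trans (card_image_le (f Q) _); apply: subset_card_le.
  move=> q /(cover _ Qd)[u [Mu us] uq]; exists u => //; split=> //=.
  by apply: ltn_trans us _; exact: KP.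
pose has_size n := `[< exists P, edge_disjoint_paths s x y P /\ P #= `I_n >].
have ex_size : exists n, has_size n.
  have [n Mn] := Mfin; exists n; apply/asboolP; exists M; split=> //.
have size_le n : has_size n -> n <= N.
  move=> /asboolP[P [Pd Pn]]; rewrite -card_le_II.
  by rewrite -(card_le_eql Pn); exact: NP.
case: (ex_maxnP ex_size size_le) => n /asboolP[P [Pd Pn]] nmax.
exists P; split=> // Q Qd; rewrite (card_le_eqr Pn).
have [m Qm] : finite_set Q.
  by apply: card_le_finite (NP _ Qd) _; exact: finite_II.
rewrite (card_le_eql Qm) card_le_II; apply: nmax.
by apply/asboolP; exists Q.
Qed.

Lemma lambdaP (V E : Type) (s : step V E) (x y : V) :
  x <> y -> maximum_edge_disjoint_paths s x y (lambda s x y).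
Proof.
move=> /(maximum_edge_disjoint_paths_exists s)[P Pmax].
exact: (xgetI set0 Pmax).
Qed.

(* Main.v *)
From mathcomp Require Import all_boot all_classical zify.
From mathcomp.classical Require Import wochoice.
From Stdlib Require List.
Require Import Defs.

(* The edge set of any graph splits into countable pieces such that a finite set
   of edges separating two vertices of a piece [H] inside [H] separates them in
   the whole graph.  This goes by induction on the cardinality: exhaust the edges
   by an increasing continuous chain of smaller sets, each closed under taking
   connecting paths outside its predecessors and, for any two of its vertices,
   under taking all members of a fixed maximal edge-disjoint family of paths,
   unless that family is larger than the set.  The connected components of the
   successive differences are the pieces of the induction step.

   Orient every piece in a well-balanced way.  If [D] is a set of [m] edges
   meeting all directed x-y paths and [X] is the set of vertices reachable from
   [x] without [D], then no piece has [2m+2] edge-disjoint paths across [X], so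
   by Menger's theorem any two of its vertices on different sides of [X] are
   separated by at most [2m+1] of its edges.  The cut of [X] is the disjoint sum
   of cuts contained in single pieces; by parity one of these separates [x] from
   [y], so at most [2m+1] edges do.  If [D] is infinite, enlarge it to a union of
   pieces; an x-y path avoiding it only meets pieces for which [m = 0]. *)

Set Implicit Arguments.
Unset Strict Implicit.
Unset Printing Implicit Defensive.

Local Open Scope classical_set_scope.
Local Open Scope card_scope.

Lemma inj_card_le (T U : Type) (f : T -> U) (A : set T) (B : set U) :
  (forall a, A a -> B (f a)) ->
  (forall a b, A a -> A b -> f a = f b -> a = b) -> A #<= B.
Proof.
move=> fAB finj; have /card_le_eql<- : f @` A #= A.
  by apply: inj_card_eq => a b; rewrite !inE; exact: finj.
by apply: subset_card_le => _ [a Aa <-]; exact: fAB.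
Qed.

Lemma card_le_inj (T U : Type) (u : U) (A : set T) (B : set U) : A #<= B ->
  exists f : T -> U, (forall a, A a -> B (f a)) /\
    (forall a b, A a -> A b -> f a = f b -> a = b).
Proof.
elim/Ppointed: U => U in u B *; first by case: (no u).
move=> /pcard_leP/injfunPex[f fAB finj]; exists f; split=> [a /fAB//|a b Aa Ab].
by apply: finj; rewrite inE.
Qed.

(** * Walks, connection and paths over a step relation *)

Section Walks.
Variables V E : Type.
Implicit Types (s t : step V E) (p q : seq (E * V)) (x y z : V) (X : set V).

Definition uses p : set E := fun e => List.In e (map fst p).

Definition conn s x y : Prop := exists p, walk s x p y.

Lemma walk_cat s x z y p q : walk s x p z -> walk s z q y -> walk s x (p ++ q) y.
Proof.
elim: p x => [|[e v] p IH] x /=; first by move=> ->.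
by move=> [sxv vp] zq; split=> //; exact: IH.
Qed.

Lemma walk_mono s t x y p :
  (forall e u v, uses p e -> s e u v -> t e u v) -> walk s x p y -> walk t x p y.
Proof.
elim: p x => [|[e v] p IH] x //= st [sxv vp]; split.
  by apply: st => //; left.
by apply: IH vp => e' u w pe'; apply: st; right.
Qed.

Lemma walk_uses s x y p e :
  walk s x p y -> uses p e -> exists u v, s e u v.
Proof.
elim: p x => [|[e' v] p IH] x //= [sxv vp] [<-|]; first by exists x, v.
exact: IH vp.
Qed.

Lemma conn_refl s x : conn s x x.
Proof. by exists [::]. Qed.

Lemma conn_trans s x z y : conn s x z -> conn s z y -> conn s x y.
Proof. by move=> [p xz] [q zy]; exists (p ++ q); exact: walk_cat xz zy. Qed.

Lemma conn_step s e x y : s e x y -> conn s x y.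
Proof. by exists [:: (e, y)]. Qed.

Lemma conn_mono s t x y :
  (forall e u v, s e u v -> t e u v) -> conn s x y -> conn t x y.
Proof.
by move=> st [p xy]; exists p; apply: walk_mono xy => e u v _; exact: st.
Qed.

Lemma conn_sym s x y :
  (forall e u v, s e u v -> s e v u) -> conn s x y -> conn s y x.
Proof.
move=> ssym [p]; elim: p x => [|[e v] p IH] x /=; first by move=> ->; exists [::].
move=> [/ssym vx /IH yv]; apply: conn_trans yv _; exact: conn_step vx.
Qed.

Lemma walk_leaves s X x y p : walk s x p y -> X x -> ~ X y ->
  exists e u v, [/\ uses p e, s e u v, X u & ~ X v].
Proof.
elim: p x => [|[e v] p IH] x /=; first by move=> ->.
move=> [sxv vp] Xx nXy; have [Xv|nXv] := pselect (X v).
  have [e' [u [w [pe' suw Xu nXw]]]] := IH _ vp Xv nXy.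
  by exists e', u, w; split=> //; right.
by exists e, x, v; split=> //; left.
Qed.

Lemma path_suffix s x y z p : is_path s z y p -> List.In x (z :: map snd p) ->
  exists q, is_path s x y q /\ uses q `<=` uses p.
Proof.
elim: p z => [|[e v] p IH] z zp /=.
  by case=> // <-; exists [::]; split.
case; first by move=> <-; exists ((e, v) :: p); split.
move=> xvp; have [|q [xq qp]] := IH v _ xvp.
  by case: zp => -[_ vp] /= /List.NoDup_cons_iff[].
by exists q; split=> // e' /qp; right.
Qed.

(** Loop erasure: whenever the new first vertex recurs on the path built so far, only the suffix
    from that recurrence is kept. Tracking [uses] lets separation be argued with walks and counted
    with paths. *)
Lemma walk_path s x y p : walk s x p y ->
  exists q, is_path s x y q /\ uses q `<=` uses p.
Proof.
elim: p x => [|[e v] p IH] x /=.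
  move=> ->; exists [::]; split=> //; split=> //=.
  by apply: List.NoDup_cons => //; exact: List.NoDup_nil.
move=> [sxv /IH[q [vq qp]]].
have [xq|nxq] := pselect (List.In x (v :: map snd q)).
  have [r [xr rq]] := path_suffix vq xq.
  by exists r; split=> // e' /rq /qp; right.
exists ((e, v) :: q); split.
  by split; [split=> //; exact: vq.1 | apply: List.NoDup_cons vq.2].
by move=> e' [<-|/qp]; [left | right].
Qed.

End Walks.

Lemma InP (T : eqType) (a : T) (l : seq T) : reflect (List.In a l) (a \in l).
Proof.
elim: l => [|b l IH] /=; first by constructor.
rewrite inE; apply: (iffP orP) => -[].
- by move/eqP=> ->; left.
- by move/IH; right.
- by move=> ->; left; exact/eqP.
- by move/IH; right.
Qed.

Lemma NoDupP (T : eqType) (l : seq T) : reflect (List.NoDup l) (uniq l).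
Proof.
elim: l => [|b l IH] /=; first by constructor; exact: List.NoDup_nil.
apply: (iffP andP) => [[/InP bl /IH ll]|/List.NoDup_cons_iff[/InP bl /IH ll]] //.
exact: List.NoDup_cons.
Qed.

Lemma uniq_unzip1_inj (S T : eqType) (l : seq (S * T)) e a b :
  uniq (unzip1 l) -> (e, a) \in l -> (e, b) \in l -> a = b.
Proof.
elim: l => [|[f c] l IH] //= /andP[fl /IH{}IH]; rewrite !inE.
case/orP=> [/eqP[ef ->]|al] /orP[/eqP[ef' ->]|bl] //; last exact: IH.
- by case/negP: fl; rewrite -ef; apply/mapP; exists (e, b).
- by case/negP: fl; rewrite -ef'; apply/mapP; exists (e, a).
Qed.

Lemma finite_set_list (T : Type) (F : set T) : finite_set F ->
  exists l : seq T, forall t, F t <-> List.In t l.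
Proof.
move=> /(@finite_seqP {classic T})[l ->]; exists l => t /=.
by split=> /(@InP {classic T}).
Qed.

Lemma list_card_le (T : Type) (l : seq T) (A : set T) :
  (forall t, A t -> List.In t l) -> A #<= `I_(size l).
Proof.
move=> Al; apply: (@inj_card_le _ _ (fun t : {classic T} => index t (l : seq {classic T}))).
  by move=> t /Al /(@InP {classic T}) /=; rewrite index_mem.
move=> t u /Al /(@InP {classic T}) tl /Al /(@InP {classic T}) ul e.
by rewrite -(@nth_index {classic T} t t l tl) e nth_index.
Qed.

(** * Menger's theorem *)

Section Menger.
Variables (V E : eqType) (s : step V E) (x y : V).
Hypothesis s_ends : forall e u v u' v', s e u v -> s e u' v' ->
  (u' = u /\ v' = v) \/ (u' = v /\ v' = u).
Implicit Types (L : seq (E * (V * V))) (p q : seq (E * V)) (n : nat).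

(* Conservation is tested against potentials [phi]; moving the negative terms
   to the other side keeps everything in [nat]. *)
Definition conserves n L := forall phi : V -> nat,
  \sum_(a <- L) phi a.2.1 + n * phi y = \sum_(a <- L) phi a.2.2 + n * phi x.

(** An integral flow of value [n] with unit capacities: uniqueness of the edges forbids both a
    double use and a use in both directions. Directed cycles in [L] are allowed. *)
Definition flow n L :=
  [/\ uniq (unzip1 L), forall e u v, (e, (u, v)) \in L -> s e u v &
      conserves n L].

Fixpoint arcs (z : V) p : seq (E * (V * V)) :=
  if p is (e, v) :: p' then (e, (z, v)) :: arcs v p' else [::].

Lemma unzip1_arcs z p : unzip1 (arcs z p) = map fst p.
Proof. by elim: p z => [|[e v] p IH] z //=; rewrite IH. Qed.

Lemma arcs_heads z p : map (fun a => a.2.2) (arcs z p) = map snd p.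
Proof. by elim: p z => [|[e v] p IH] z //=; rewrite IH. Qed.

Lemma walk_arcs (t : step V E) z p e u v : walk t z p y ->
  (e, (u, v)) \in arcs z p -> t e u v.
Proof.
elim: p z => [|[e' w] p IH] z //= [tzw wp]; rewrite inE => /orP[/eqP[-> -> ->]//|].
exact: IH.
Qed.

Lemma sum_arcs (phi : V -> nat) (t : step V E) z p : walk t z p y ->
  \sum_(a <- arcs z p) phi a.2.1 + phi y = \sum_(a <- arcs z p) phi a.2.2 + phi z.
Proof.
elim: p z => [|[e w] p IH] z /=; first by move=> ->; rewrite !big_nil.
by move=> [_ /IH]; rewrite !big_cons /=; lia.
Qed.

Lemma path_arcs_uniq (t : step V E) z p : is_path t z y p -> uniq (arcs z p).
Proof.
move=> [_ /NoDupP]; rewrite -(arcs_heads z) => /= /andP[_].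
exact: map_uniq.
Qed.

Definition in_arcs L : step V E := fun e u v => (e, (u, v)) \in L.

(** Conservation is tested on the indicator of the set reachable from [x] along arcs of [L]. No arc
    leaves this set, so its heads outweigh its tails, and the positive value forces [y] into it. *)
Lemma flow_conn n L : flow n.+1 L -> conn (in_arcs L) x y.
Proof.
move=> [_ _ Lc]; pose phi v : nat := `[< conn (in_arcs L) x v >].
have := Lc phi; have -> : phi x = 1.
  by rewrite /phi asboolT //; exact: conn_refl.
have : \sum_(a <- L) phi a.2.1 <= \sum_(a <- L) phi a.2.2.
  rewrite big_seq [leqRHS]big_seq; apply: leq_sum => -[e [u v]] /= aL.
  rewrite /phi; case: asboolP => //= xu; rewrite asboolT //.
  by apply: conn_trans xu _; exact: (@conn_step _ _ _ e).
by rewrite /phi; case: asboolP => //= _; lia.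
Qed.

(** Paths are peeled off one at a time: removing the arcs of one leaves a flow of value one less.
    The last clause keeps the later paths on the remaining edges, hence disjoint from the path
    removed. *)
Lemma flow_decomposition n L : flow n L ->
  exists ps : seq (seq (E * V)),
  [/\ size ps = n, forall p, p \in ps -> is_path s x y p,
      uniq (flatten (map (map fst) ps)) &
      {subset flatten (map (map fst) ps) <= unzip1 L}].
Proof.
elim: n L => [|n IH] L Lf; first by exists [::].
have [q xqy] := flow_conn Lf.
have [p [pP _]] := walk_path xqy.
have pu := path_arcs_uniq pP.
have pL : {subset arcs x p <= L} by move=> [e [u v]]; exact: (walk_arcs pP.1).
have [Lu Ls Lc] := Lf.
pose L' := [seq a <- L | a \notin arcs x p].
have permL : perm_eq L (arcs x p ++ L').
  rewrite -(perm_filterC (mem (arcs x p)) L) perm_cat2r; apply: uniq_perm => //.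
    by rewrite filter_uniq //; exact: map_uniq Lu.
  by move=> a; rewrite mem_filter; apply/andP/idP => [[]//|ap]; split=> //; exact: pL.
have permE : perm_eq (unzip1 L) (map fst p ++ unzip1 L').
  by rewrite -(unzip1_arcs x) /unzip1 -map_cat; exact: perm_map.
have [|ps [psn psP psu psL]] := IH L'.
  split.
  - by move: Lu; rewrite (perm_uniq permE) cat_uniq => /and3P[].
  - by move=> e u v; rewrite mem_filter => /andP[_ /Ls].
  - move=> phi; have := Lc phi; have := sum_arcs phi pP.1.
    rewrite (perm_big _ permL) [in X in _ -> _ = X -> _](perm_big _ permL) /=.
    by rewrite !big_cat /=; lia.
exists (p :: ps); split=> /=.
- by rewrite psn.
- move=> r; rewrite inE => /orP[/eqP->|/psP//].
  split; last exact: pP.2.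
  by apply: walk_mono pP.1 => e u v _; exact: Ls.
- move: Lu; rewrite (perm_uniq permE) !cat_uniq => /and3P[-> pL' _]; rewrite psu andbT.
  apply: contra pL' => /hasP[e eps ep]; apply/hasP; exists e => //.
  exact: psL.
- move=> e; rewrite mem_cat (perm_mem permE) mem_cat => /orP[->//|/psL->].
  by rewrite orbT.
Qed.

(** Free edges may be traversed as [s] permits, edges carrying flow only against it. *)
Definition residual L : step V E := fun e u v =>
  (s e u v /\ e \notin unzip1 L) \/ (e, (v, u)) \in L.

(** By [s_ends] a second use of the edge leaving [z] would revisit [z]. This matters because [s] may
    allow both directions of an edge, as [link] does. *)
Lemma path_edges_uniq (t : step V E) z p :
  (forall e u v, t e u v -> s e u v \/ s e v u) ->
  is_path t z y p -> uniq (map fst p).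
Proof.
move=> ts; elim: p z => [|[e v] p IH] z //= [[tzv vp] /List.NoDup_cons_iff[zvp nd]].
rewrite (IH v) ?andbT //; apply/negP => /InP.
have st u w a b : t e u w -> t e a b -> (a = u /\ b = w) \/ (a = w /\ b = u).
  by move=> /ts[]suw /ts[]sab; have := s_ends suw sab; tauto.
have {IH nd} : forall w, walk t w p y -> ~ List.In z (w :: map snd p) ->
    ~ List.In e (map fst p).
  elim: p {vp zvp nd IH} => [|[f a] p IH] w /=; first by move=> _ _ [].
  move=> [twa ap] nz [fe|].
    rewrite {}fe in twa; have [[wz _]|[_ az]] := st _ _ _ _ tzv twa.
      by apply: nz; left.
    by apply: nz; right; left.
  by apply: IH ap _ => za; apply: nz; right.
by move=> h; exact: (h v vp zvp).
Qed.

(** The new flow is the symmetric difference with an augmenting path: the flow arcs [L2] cancel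
    against the path arcs [A2], which are their reversals, while [L1] and [A1] stay. *)
Lemma flow_augment n L : flow n L -> conn (residual L) x y ->
  exists L', flow n.+1 L'.
Proof.
move=> [Lu Ls Lc] [q xqy]; have [p [pP _]] := walk_path xqy.
have pe : uniq (map fst p).
  apply: path_edges_uniq pP => e u v [[suv _]|/Ls]; tauto.
have pres e u v : (e, (u, v)) \in arcs x p -> residual L e u v.
  exact: (walk_arcs pP.1).
pose L1 := [seq a <- L | a.1 \notin map fst p].
pose L2 := [seq a <- L | a.1 \in map fst p].
pose A1 := [seq a <- arcs x p | a.1 \notin unzip1 L].
pose A2 := [seq a <- arcs x p | a.1 \in unzip1 L].
pose rev (a : E * (V * V)) := (a.1, (a.2.2, a.2.1)).
have Au : uniq (arcs x p) := path_arcs_uniq pP.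
have perm2 : perm_eq L2 (map rev A2).
  have revinj : injective rev.
    by move=> [e [u v]] [e' [u' v']]; rewrite /rev /= => -[-> -> ->].
  apply: uniq_perm; first by rewrite filter_uniq //; exact: map_uniq Lu.
    by rewrite map_inj_uniq // filter_uniq.
  move=> [e [u v]].
  have -> : (e, (u, v)) = rev (e, (v, u)) by [].
  rewrite mem_map // !mem_filter /=; apply/andP/andP => -[].
    rewrite -(unzip1_arcs x) => /mapP[[e' [a b]] aA /= ee']; subst e' => eL.
    split; first by apply/mapP; exists (e, (u, v)).
    case: (pres _ _ _ aA) => [[_ /negP[]]|ba].
      by apply/mapP; exists (e, (u, v)).
    by have [<- <-] := uniq_unzip1_inj Lu ba eL.
  move=> eL aA; split.
    by rewrite -(unzip1_arcs x); apply/mapP; exists (e, (v, u)).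
  by case: (pres _ _ _ aA) => // -[_]; rewrite eL.
exists (L1 ++ A1); split.
- rewrite /unzip1 map_cat cat_uniq; apply/and3P; split.
  + exact: subseq_uniq (map_subseq _ (filter_subseq _ _)) Lu.
  + apply/hasPn => e /mapP[a]; rewrite mem_filter => /andP[aL _] ->.
    apply: contra aL => /mapP[b]; rewrite mem_filter => /andP[_ bL] ->.
    by apply/mapP; exists b.
  + apply: subseq_uniq (map_subseq _ (filter_subseq _ _)) _.
    by rewrite -/(unzip1 _) unzip1_arcs.
- move=> e u v; rewrite mem_cat !mem_filter /= => /orP[/andP[_ /Ls]//|].
  move=> /andP[eL /pres[[]//|vu]].
  by case/negP: eL; apply/mapP; exists (e, (v, u)).
- move=> phi; have := Lc phi; have := sum_arcs phi pP.1.
  have permL : perm_eq L (L2 ++ L1).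
    by rewrite perm_sym; exact/permPl/perm_filterC.
  have permA : perm_eq (arcs x p) (A2 ++ A1).
    by rewrite perm_sym; exact/permPl/perm_filterC.
  do 2 rewrite (perm_big _ permA) /= big_cat /=.
  rewrite (perm_big _ permL) /= [in X in _ -> _ = X -> _](perm_big _ permL) /=.
  rewrite !big_cat /= (perm_big _ perm2) /= [in X in _ -> _ = X -> _](perm_big _ perm2) /=.
  by rewrite !big_map /=; lia.
Qed.

Definition cut (C : seq E) := forall p, walk s x p y -> exists2 e, e \in C & uses p e.

(** The cut consists of the flow edges leaving the residually reachable set [X]. No flow arc enters
    [X], since its reversal would be residual, so conservation on the indicator of [X] counts them;
    any other edge leaving [X] would be residual as well. *)
Lemma flow_cut n L : flow n L -> ~ conn (residual L) x y ->
  exists2 C, size C <= n & cut C.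
Proof.
move=> [Lu Ls Lc] nxy; pose X := [set v | conn (residual L) x v].
have Xx : X x by exact: conn_refl.
have Xstep e u v : residual L e u v -> X u -> X v.
  by move=> r; rewrite /X /= => xu; apply: conn_trans xu _; exact: conn_step r.
pose out (a : E * (V * V)) := `[< X a.2.1 >] && ~~ `[< X a.2.2 >].
exists (unzip1 [seq a <- L | out a]).
  rewrite size_map size_filter -sum1_count.
  have := Lc (fun v => `[< X v >]); rewrite (asboolT Xx) (asboolF nxy) /=.
  rewrite (bigID out) /= [X in _ = X + _](bigID out) /=.
  have -> : \sum_(i <- L | out i) `[< X i.2.1 >] = \sum_(i <- L | out i) 1.
    by apply: eq_bigr => a /andP[-> _].
  have -> : \sum_(i <- L | ~~ out i) `[< X i.2.1 >] =
            \sum_(i <- L | ~~ out i) `[< X i.2.2 >].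
    rewrite big_seq_cond [RHS]big_seq_cond; apply: eq_bigr => -[e [u v]] /=.
    rewrite /out /= => /andP[aL].
    case: asboolP => Xu; case: asboolP => Xv //=.
    by case: Xu; apply: Xstep Xv; right; exact: aL.
  rewrite [X in _ = X + _ + _]big1 => [|a /andP[_ /negbTE->] //]; lia.
move=> p xpy; have [e [u [v [pe suv Xu nXv]]]] := walk_leaves xpy Xx nxy.
exists e => //; have [eL|eL] := boolP (e \in unzip1 L); last first.
  by case: nXv; apply: Xstep Xu; left; split; eauto.
case/mapP: eL => -[e' [a b]] aL /= ee'; subst e'.
apply/mapP; exists (e, (a, b)) => //; rewrite mem_filter aL andbT /out /=.
have [[-> ->]|[av bu]] := s_ends suv (Ls _ _ _ aL).
  by rewrite asboolT //= asboolF.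
by case: nXv; apply: Xstep Xu; right; rewrite -av -bu; exact: aL.
Qed.

Lemma flow_or_cut n : (exists L, flow n L) \/ (exists2 C, size C < n & cut C).
Proof.
elim: n => [|n [[L Lf]|[C Cn Cc]]].
- by left; exists [::]; split=> // phi; rewrite !big_nil.
- have [xy|nxy] := pselect (conn (residual L) x y).
    by left; exact: flow_augment xy.
  by right; have [C Cn Cc] := flow_cut Lf nxy; exists C.
- by right; exists C => //; exact: ltnW.
Qed.

Lemma menger_eqType n : x <> y -> lambda s x y #<= `I_n -> exists2 C, size C <= n & cut C.
Proof.
move=> xy ln; have [[L Lf]|//] := flow_or_cut n.+1.
have [ps [psn psP psu _]] := flow_decomposition Lf.
(* As [x <> y], every path has an edge, so disjointness of the edge lists makes the [n.+1] paths
   distinct. *)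
have pN0 p : p \in ps -> exists e, e \in map fst p.
  by move=> /psP; case: p => [[/xy]//|[e v] p _]; exists e; rewrite inE eqxx.
have [dis nd] : (forall p q, p \in ps -> q \in ps -> p <> q -> edge_disjoint p q)
    /\ uniq ps.
  move: pN0 psu; clear; elim: ps => [|r ps IH] //= pN0.
  rewrite cat_uniq => /and3P[_ /hasPn rps psu].
  have [|dis nd] := IH _ psu; first by move=> p pps; apply: pN0; rewrite inE pps orbT.
  have rdis p e : p \in ps -> e \in map fst p -> e \in map fst r -> False.
    move=> pps ep er; have /negP[] : e \notin map fst r; last by [].
    by apply: rps; apply/flattenP; exists (map fst p) => //; exact: map_f.
  split.
    move=> p q; rewrite !inE => /orP[/eqP->|pps] /orP[/eqP->|qps] // pq e [].
    - by move=> /InP er /InP eq; exact: rdis qps eq er.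
    - by move=> /InP ep /InP er; exact: rdis pps ep er.
    - by move=> ep eq; exact: dis pps qps pq e (conj ep eq).
  rewrite nd andbT; apply/negP => rr.
  have [|e er] := pN0 r; first by rewrite inE eqxx.
  exact: (rdis _ _ rr er er).
have [_ lmax] := lambdaP s xy.
have : [set p | p \in ps] #<= lambda s x y.
  by apply: lmax; split=> [p|p q] /=; [exact: psP | exact: dis].
move=> /card_le_trans/(_ ln) psle.
suff : `I_n.+1 #<= `I_n by rewrite card_le_II ltnn.
apply: card_le_trans psle; apply: (@inj_card_le _ _ (nth [::] ps)).
  by move=> i /= i_n; rewrite mem_nth // psn.
by move=> i j; rewrite /= -psn => il jl /eqP; rewrite nth_uniq // => /eqP.
Qed.

End Menger.

Lemma menger (V E : Type) (s : step V E) (x y : V) n :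
  (forall e u v u' v', s e u v -> s e u' v' ->
    (u' = u /\ v' = v) \/ (u' = v /\ v' = u)) ->
  x <> y -> lambda s x y #<= `I_n ->
  exists C : set E, C #<= `I_n /\ ~ conn (fun e u v => s e u v /\ ~ C e) x y.
Proof.
move=> s_ends xy /(@menger_eqType {classic V} {classic E} _ _ _ s_ends _ xy)[C Cn Ccut].
exists [set e | List.In e C]; split.
  apply: card_le_trans (list_card_le (l := C) _) _ => //.
  by rewrite card_le_II.
move=> [p xpy]; have [|e /(@InP {classic E}) Ce pe] := Ccut p.
  by apply: walk_mono xpy => e u v _ [].
by have [u [v []]] := walk_uses xpy pe.
Qed.

(** * Decomposition into countable cut-faithful pieces *)

Section Trees.
Variable W : Type.

Inductive tree := Leaf of nat | Elt of W | Pair of tree & tree.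

Fixpoint tree_in (A : set W) (t : tree) : Prop :=
  match t with
  | Leaf _ => True
  | Elt w => A w
  | Pair t1 t2 => tree_in A t1 /\ tree_in A t2
  end.

(* [trees A] has cardinality [max #|A| aleph_0], but is closed under pairing on
   the nose: measuring sets against [trees A] needs no cardinal arithmetic. *)
Definition trees (A : set W) : set tree := [set t | tree_in A t].

Lemma trees_sub (A B : set W) : A `<=` B -> trees A `<=` trees B.
Proof.
move=> AB; elim=> [n|w|t1 IH1 t2 IH2] //=; first exact: AB.
by move=> [/IH1 ? /IH2 ?].
Qed.

Lemma countable_trees T (A : set W) (X : set T) : countable X -> X #<= trees A.
Proof.
move=> /card_le_trans; apply; apply: (@inj_card_le _ _ Leaf) => // m n _ _.
by case.
Qed.

Lemma trees0_countable : countable (trees set0).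
Proof.
pose fix code (t : tree) : nat :=
  match t with
  | Leaf n => choice.pickle (inl n : nat + nat * nat)
  | Elt _ => 0
  | Pair t1 t2 => choice.pickle (inr (code t1, code t2) : nat + nat * nat)
  end.
apply: (@inj_card_le _ _ code) => // t t'.
have pinj := pcan_inj (@choice.pickleK (nat + nat * nat)%type).
elim: t t' => [n|w|t1 IH1 t2 IH2] [n'|w'|t1' t2'] //=.
- by move=> _ _ /pinj[->].
- by move=> _ _ /pinj.
- by move=> _ _ /pinj.
- by move=> [? ?] [? ?] /pinj[/IH1-> // /IH2->].
Qed.

(** An element is coded by the [Pair] of the code of one chosen index and its own code within that
    member of the union. *)
Lemma bigcup_trees I T (A : set W) (Q : set I) (B : I -> set T) :
  Q #<= trees A -> (forall i, Q i -> B i #<= trees A) ->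
  \bigcup_(i in Q) B i #<= trees A.
Proof.
move=> /(card_le_inj (Leaf 0))[f [fA finj]] BA.
have /choice[g gP] : forall i, exists g : T -> tree, Q i ->
    (forall t, B i t -> trees A (g t)) /\
    (forall t u, B i t -> B i u -> g t = g u -> t = u).
  move=> i; have [Qi|nQi] := pselect (Q i).
    by have [g gP] := card_le_inj (Leaf 0) (BA _ Qi); exists g.
  by exists (fun=> Leaf 0).
have /choice[h hP] : forall t, exists r, (\bigcup_(i in Q) B i) t ->
    exists i, [/\ Q i, B i t & r = Pair (f i) (g i t)].
  move=> t; have [[i Qi Bi]|nt] := pselect ((\bigcup_(i in Q) B i) t).
    by exists (Pair (f i) (g i t)) => _; exists i.
  by exists (Leaf 0).
apply: (@inj_card_le _ _ h) => [t /hP[i [Qi Bi ->]]|t u /hP[i [Qi Bi ->]]].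
  by split; [exact: fA | exact: (gP _ Qi).1].
move=> /hP[j [Qj Bj ->]] [/(finj _ _ Qi Qj) ij]; subst j.
exact: (gP _ Qi).2.
Qed.

Lemma setU_trees T (A : set W) (X Y : set T) :
  X #<= trees A -> Y #<= trees A -> X `|` Y #<= trees A.
Proof.
move=> XA YA; have := @bigcup_trees bool T A setT (fun b => if b then X else Y).
move=> /(_ (countable_trees _ (countableP _))); move=> h.
apply: card_le_trans (h _); last by case.
by apply: subset_card_le => t [Xt|Yt]; [exists true | exists false].
Qed.

Lemma seqs_trees T (A : set W) (X : set T) : X #<= trees A ->
  [set l : seq T | forall t, List.In t l -> X t] #<= trees A.
Proof.
move=> /(card_le_inj (Leaf 0))[f [fA finj]].
apply: (@inj_card_le _ _ (foldr (fun t r => Pair (f t) r) (Leaf 0))).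
  elim=> [|t l IH] //= Xl; split; first by apply: fA; apply: Xl; left.
  by apply: IH => u lu; apply: Xl; right.
elim=> [|t l IH] [|t' l'] //= Xl Xl' [/finj-> //].
- by move=> /IH-> // u lu; [apply: Xl | apply: Xl']; right.
- by apply: Xl; left.
- by apply: Xl'; left.
Qed.

(** Shifting all leaves by one frees [Leaf 0] to stand for [a]. This is what makes a stage indexed
    over [upto a] no larger than [trees (below a)]. *)
Lemma trees_setU1 (A : set W) (a : W) : trees (A `|` [set a]) #<= trees A.
Proof.
pose fix f (t : tree) : tree :=
  match t with
  | Leaf n => Leaf n.+1
  | Elt w => if pselect (A w) then Elt w else Leaf 0
  | Pair t1 t2 => Pair (f t1) (f t2)
  end.
apply: (@inj_card_le _ _ f).
  by elim=> [n|w|t1 IH1 t2 IH2] //= => [_|[/IH1 ? /IH2 ?]//]; case: pselect.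
elim=> [n|w|t1 IH1 t2 IH2] [n'|w'|t1' t2'] //=.
- by move=> _ _ [->].
- by move=> _ _; case: pselect.
- by move=> _ _; case: pselect.
- move=> Aw Aw'; case: pselect => nw; case: pselect => nw' // _.
  by case: Aw => // ->; case: Aw' => // ->.
- by move=> _ _; case: pselect.
- by move=> _ _; case: pselect.
- by move=> [? ?] [? ?] [/IH1-> // /IH2->].
Qed.

End Trees.

(** * Closure of a set under an operation on finite lists *)

Section Hull.
Variables (E : Type) (op : seq E -> set E) (A : set E).

Definition hull_stage (n : nat) : set E :=
  iter n (fun B => B `|` \bigcup_(l in [set l | forall e, List.In e l -> B e]) op l) A.

Definition hull : set E := \bigcup_n hull_stage n.

Lemma hull_sub : A `<=` hull.
Proof. by move=> e Ae; exists 0. Qed.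

Lemma hull_stage_mono m n : m <= n -> hull_stage m `<=` hull_stage n.
Proof.
move=> /subnK <-; elim: (n - m) => [|k IH] //= e /IH; by left.
Qed.

(** The stages increase and a list is finite, so it lies in a single stage; hence countably many
    stages suffice. *)
Lemma hull_op l : (forall e, List.In e l -> hull e) -> op l `<=` hull.
Proof.
move=> lc; have [n ln] : exists n, forall e, List.In e l -> hull_stage n e.
  elim: l lc => [|e l IH] lc; first by exists 0.
  have [|n ln] := IH; first by move=> f lf; apply: lc; right.
  have [|m _ me] := lc e; first by left.
  exists (maxn m n) => f [<-|/ln]; first exact: hull_stage_mono (leq_maxl _ _) _ me.
  exact: hull_stage_mono (leq_maxr _ _) _.
by move=> e le; exists n.+1 => //=; right; exists l.
Qed.

Lemma hull_ind (T : set E) : A `<=` T ->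
  (forall l, op l `<=` T) -> hull `<=` T.
Proof.
move=> AT opT e [n _]; elim: n e => [|n IH] e /=; first exact: AT.
by case=> [/IH//|[l _ /opT]].
Qed.

Lemma hull_trees (W : Type) (K : set W) : A #<= trees K ->
  (forall l, op l #<= trees K) -> hull #<= trees K.
Proof.
move=> AK opK; apply: bigcup_trees => [|n _].
  by apply: countable_trees; exact: countableP.
elim: n => [|n IH] //=; apply: setU_trees => //.
by apply: bigcup_trees => // ; exact: seqs_trees.
Qed.

End Hull.

(** * Strict well-orders *)

Definition strict_well_order (W : Type) (lt : W -> W -> Prop) : Prop :=
  [/\ well_founded lt, forall u v w, lt u v -> lt v w -> lt u w &
      forall u v, [\/ lt u v, u = v | lt v u]].

Lemma strict_well_order_exists (T : Type) :
  exists lt : T -> T -> Prop, strict_well_order lt.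
Proof.
have [R Rwo] := well_ordering_principle {classic T}.
have Rmin (A : set T) t : A t -> exists z, A z /\ forall u, A u -> R z u.
  move=> At; have [|z [[zA zmin] _]] := Rwo (fun t => `[< A t >]).
    by exists t; apply/asboolP.
  exists z; split; first exact/asboolP.
  by move=> u Au; apply: zmin; apply/asboolP.
(* The well-ordering principle provides unique minima; here both [u] and [v] would be minima of the
   pair. *)
have Ranti u v : R u v -> R v u -> u = v.
  have Rrefl w : R w w by have [z [-> /(_ w erefl)]] := @Rmin [set w] w erefl.
  move=> uv vu; have [|z [_ zu]] := Rwo (fun t => `[< t = u \/ t = v >]).
    by exists u; apply/asboolP; left.
  rewrite -(zu u) ?(zu v) //; split; try by [apply/asboolP; left|apply/asboolP; right].
    by move=> w /asboolP[]->.
  by move=> w /asboolP[]->.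
exists (fun u v => ~~ R v u); split.
- move=> t; apply: contrapT => nt.
  have [z [nz zmin]] := Rmin [set u | ~ Acc (fun u v => ~~ R v u) u] t nt.
  apply: nz; constructor => u zu; apply: contrapT => nu.
  by move: zu; rewrite zmin.
(* Transitivity is read off the minimum of [u], [v], [w], which can only be [u]. *)
- move=> u v w vu wv.
  have [z [zA zmin]] := Rmin [set t | [\/ t = u, t = v | t = w]] u (Or31 _ _ erefl).
  have zu := zmin u (Or31 _ _ erefl); have zv := zmin v (Or32 _ _ erefl).
  have zw := zmin w (Or33 _ _ erefl).
  case: zA => zE; rewrite {}zE in zu zv zw; last 2 first.
  + by rewrite zu in vu.
  + by rewrite zv in wv.
  by apply/negP => wu; rewrite (Ranti _ _ wu zw) zv in wv.
- move=> u v; have [uv|] := boolP (R u v); last by constructor 3.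
  have [vu|] := boolP (R v u); last by constructor 1.
  by constructor 2; exact: Ranti.
Qed.

Lemma strict_well_order_min (W : Type) (lt : W -> W -> Prop) (A : set W) a :
  well_founded lt -> A a -> exists2 m, A m & forall b, A b -> ~ lt b m.
Proof.
move=> wf; elim/(well_founded_ind wf): a => a IH Aa.
have [[b Ab ba]|nb] := pselect (exists2 b, A b & lt b a); first exact: IH ba Ab.
by exists a => // b Ab ba; apply: nb; exists b.
Qed.

(** Each path is sent to one of its edges in [Y]; edge-disjointness makes this choice injective. *)
Lemma edge_disjoint_meet_card (V E : Type) (P Q : set (seq (E * V))) (Y : set E) :
  (forall p q, P p -> P q -> p <> q -> edge_disjoint p q) -> Q `<=` P ->
  (forall p, Q p -> exists2 e, Y e & uses p e) -> Q #<= Y.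
Proof.
move=> Pdis QP QY; have [[q Qq]|nQ] := pselect (exists q, Q q); last first.
  suff -> : Q = set0 by exact: card_ge0.
  by apply/seteqP; split=> // q Qq; apply: nQ; exists q.
have [e0 _ _] := QY _ Qq.
have /choice[f fP] : forall p, exists e, Q p -> Y e /\ uses p e.
  move=> p; have [/QY[e Ye pe]|nQ] := pselect (Q p); first by exists e.
  by exists e0.
apply: (@inj_card_le _ _ f) => [p /fP[]//|p r Qp Qr fpr]; apply: contrapT => pr.
apply: (Pdis _ _ (QP _ Qp) (QP _ Qr) pr (f p)); split; first exact: (fP _ Qp).2.
by rewrite fpr; exact: (fP _ Qr).2.
Qed.

(** * Edge sets, cut-faithfulness and maximal families of paths *)

Section EdgeSets.
Variables (V E : Type) (ends : E -> set V).
Implicit Types (S H F N : set E) (u v : V) (p : seq (E * V)).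

Definition elink S : step V E := fun e u v => S e /\ ends e = [set u; v].

Definition everts S : set V := [set u | exists2 e, S e & ends e u].

Definition two_ended S : Prop := forall e, S e -> exists u v, ends e = [set u; v].

(* Every finite cut of [H] separates the same vertices of [H] in all of [S]. *)
Definition cut_faithful S H : Prop := forall F, finite_set F ->
  forall u v, everts H u -> everts H v ->
    conn (elink (S `\` F)) u v -> conn (elink (H `\` F)) u v.

Definition edge_partition S (h : E -> set E) : Prop := forall e, S e ->
  [/\ h e e, h e `<=` S & forall e', h e e' -> h e' = h e].

Lemma elink_sym S e u v : elink S e u v -> elink S e v u.
Proof. by rewrite /elink setUC. Qed.

Lemma conn_elink_sym S u v : conn (elink S) u v -> conn (elink S) v u.
Proof. by apply: conn_sym => e a b; exact: elink_sym. Qed.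

Lemma conn_elink_sub S H u v : S `<=` H -> conn (elink S) u v -> conn (elink H) u v.
Proof. by move=> SH; apply: conn_mono => e a b [/SH]. Qed.

Lemma walk_elink S S' u p v : walk (elink S) u p v -> uses p `<=` S' ->
  walk (elink S') u p v.
Proof. by move=> + pS; apply: walk_mono => e a b /pS Se [_]. Qed.

Lemma uses_elink S u p v : walk (elink S) u p v -> uses p `<=` S.
Proof. by move=> up e /(walk_uses up)[a [b []]]. Qed.

Lemma ends_conn S e u v : two_ended S -> S e -> ends e u -> ends e v ->
  conn (elink S) u v.
Proof.
move=> tS Se; have [a [b eab]] := tS _ Se; rewrite eab => -[]-> []->;
  try exact: conn_refl; apply: (@conn_step _ _ _ e).
- by split.
- by apply: elink_sym; split.
Qed.

Lemma ends_nonempty S e : two_ended S -> S e -> exists u, ends e u.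
Proof. by move=> tS /tS[u [v ->]]; exists u; left. Qed.

End EdgeSets.

(** Maximality under inclusion, phrased as the property that is used: no walk avoids all edges of
    the family. *)
Definition maximal_family (V E : Type) (s : step V E) u v
    (P : set (seq (E * V))) : Prop :=
  edge_disjoint_paths s u v P /\
  forall p, walk s u p v -> exists q e, [/\ P q, uses q e & uses p e].

Lemma maximal_family_exists (V E : Type) (s : step V E) u v : u <> v ->
  exists P, maximal_family s u v P.
Proof.
move=> uv.
have [F FP Ftot|P [[Ppath Pdis] Pmax]] := @Zorn_bigcup _ (edge_disjoint_paths s u v).
  split=> [p [X FX Xp]|p q [X FX Xp] [Y FY Yq]]; first exact: (FP _ FX).1.
  have [XY|YX] := Ftot _ _ FX FY.
    by apply: (FP _ FY).2 => //; exact: XY.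
  by apply: (FP _ FX).2 => //; exact: YX.
exists P; split=> // p' up'; have [p [up pp']] := walk_path up'.
apply: contrapT => no.
have {pp'}no q e : P q -> uses q e -> ~ uses p e.
  by move=> Pq qe /pp' pe; apply: no; exists q, e.
have nPp : ~ P p.
  case: p up no => [[/= /uv//]|[e w] p _ no Pp].
  by apply: (no _ e Pp); left.
apply: (Pmax (P `|` [set p])).
  by split; [move=> q; left | move=> /(_ p (or_intror erefl))].
split=> [q [/Ppath//|->//]|q r [Pq|->] [Pr|->]] //.
- exact: Pdis.
- by move=> _ e [qe]; exact: no qe.
- by move=> _ e [pe re]; exact: no re pe.
Qed.

(** * The chain of closed edge sets and the components of its layers *)

Section Filtration.
Variables (V E W : Type) (ends : E -> set V) (lt : W -> W -> Prop).
Hypothesis lt_wo : strict_well_order lt.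
Variables (S : set E) (c : W).
Hypothesis S_ends : two_ended ends S.

Local Notation lk := (elink ends).
Local Notation verts := (everts ends).

Definition below (a : W) : set W := [set b | lt b a].
Definition upto (a : W) : set W := below a `|` [set a].

(* [iota] and [g u v] index the edges and the members of the maximal family
   [P u v]; by [g_min], whenever some member of [P u v] has an index outside
   [trees (below a)], that set is too small to index the family at all.
   [q N u v l] is a walk from [u] to [v] avoiding [N] and [l], if there is one. *)
Variables (iota : E -> tree W) (P : V -> V -> set (seq (E * V))).
Variables (g : V -> V -> seq (E * V) -> tree W).
Variable (q : set E -> V -> V -> seq E -> seq (E * V)).
Hypothesis iotaP : forall e, S e -> trees (below c) (iota e).
Hypothesis iota_inj : forall e f, S e -> S f -> iota e = iota f -> e = f.
Hypothesis P_max : forall u v, u <> v -> maximal_family (lk S) u v (P u v).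
Hypothesis g_inj : forall u v, u <> v -> forall p r, P u v p -> P u v r ->
  g u v p = g u v r -> p = r.
Hypothesis g_min : forall u v, u <> v -> forall a p, P u v p ->
  ~ trees (below a) (g u v p) -> ~ (P u v #<= trees (below a)).
Hypothesis qP : forall N u v l,
  conn (lk (S `\` N `\` [set e | List.In e l])) u v ->
  walk (lk (S `\` N `\` [set e | List.In e l])) u (q N u v l) v.

Let lt_wf : well_founded lt. Proof. by case: lt_wo. Qed.
Let lt_trans u v w : lt u v -> lt v w -> lt u w. Proof. by case: lt_wo => _ + _; apply. Qed.
Let lt_total u v : [\/ lt u v, u = v | lt v u]. Proof. by case: lt_wo. Qed.

(** One list encodes all arguments: the first two edges name the vertices [u] and [v] as ends of
    theirs, and the tail is the finite set of edges to be avoided. *)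
Definition op (a : W) (N : set E) (l : seq E) : set E :=
  if l is e1 :: e2 :: l' then
    [set e | exists u v, [/\ S e1 /\ S e2, ends e1 u, ends e2 v, u <> v &
      (walk (lk (S `\` N `\` [set e | List.In e l'])) u (q N u v l') v /\
       uses (q N u v l') e) \/
      (exists p, [/\ P u v p, trees (upto a) (g u v p) & uses p e])]]
  else set0.

(** The edges indexed over [upto a] are added so that the stages exhaust [S]. *)
Definition next_stage (a : W) (N : set E) : set E :=
  hull (op a N) (N `|` [set e | S e /\ trees (upto a) (iota e)]).

Definition stage : W -> set E :=
  Fix lt_wf (fun _ => set E) (fun a rec =>
    next_stage a [set e | exists b (ba : lt b a), rec b ba e]).

Definition before (a : W) : set E := \bigcup_(b in below a) stage b.

Lemma stageE a : stage a = next_stage a (before a).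
Proof.
rewrite /stage Fix_eq -/stage.
  congr (next_stage a _); apply/seteqP; split=> e /=.
    by move=> [b [ba be]]; exists b.
  by move=> [b ba be]; exists b, ba.
move=> b f1 f2 f12; congr (next_stage b _); apply/seteqP.
by split=> e [d [db de]]; exists d, db; rewrite ?f12 // -f12.
Qed.

Lemma stage_before a b : lt b a -> stage b `<=` before a.
Proof. by move=> ba e be; exists b. Qed.

Lemma before_stage a : before a `<=` stage a.
Proof. by move=> e ae; rewrite stageE; apply: hull_sub; left. Qed.

Lemma stage_sub a : stage a `<=` S.
Proof.
elim/(well_founded_ind lt_wf): a => a IH; rewrite stageE; apply: hull_ind.
  by move=> e [[b ba /(IH _ ba)]|[]].
move=> [|e1 [|e2 l]] // e [u [v [_ _ _ uv [[qw qe]|[p [Pp _ pe]]]]]].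
  by have [[]] := uses_elink qw qe.
have [[Pw _] _] := P_max uv.
exact: uses_elink (Pw _ Pp).1 _ pe.
Qed.

Lemma list_trees (A : set W) (l : seq E) : [set e | List.In e l] #<= trees A.
Proof.
apply: countable_trees; apply: finite_set_countable.
exact: card_le_finite (list_card_le (l := l) _) (finite_II _).
Qed.

Lemma ends_trees (A : set W) e : S e -> ends e #<= trees A.
Proof.
move=> Se; have [u [v ->]] := S_ends Se.
by apply: countable_trees; apply: finite_set_countable; exact: finite_set2.
Qed.

Lemma op_trees a N l : op a N l #<= trees (upto a).
Proof.
case: l => [|e1 [|e2 l]]; try exact: card_ge0.
have [Se1|ne1] := pselect (S e1); last first.
  by apply: card_le_trans (card_ge0 _ _); apply: subset_card_le => e [u [v [[]]]].
have [Se2|ne2] := pselect (S e2); last first.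
  by apply: card_le_trans (card_ge0 _ _); apply: subset_card_le => e [u [v [[]]]].
pose X u v : set E := [set e | uses (q N u v l) e] `|`
  \bigcup_(p in [set p | [/\ P u v p, u <> v & trees (upto a) (g u v p)]]) uses p.
apply: (@card_le_trans _ _ _ (\bigcup_(u in ends e1) \bigcup_(v in ends e2) X u v)).
  apply: subset_card_le => e [u [v [_ eu ev uv [[_ qe]|[p [Pp pa pe]]]]]].
    by exists u => //; exists v => //; left.
  by exists u => //; exists v => //; right; exists p.
apply: bigcup_trees (ends_trees _ Se1) _ => u _.
apply: bigcup_trees (ends_trees _ Se2) _ => v _.
apply: setU_trees; first exact: list_trees.
apply: bigcup_trees => [|p _]; last exact: list_trees.
apply: (@inj_card_le _ _ (g u v)) => [p []//|p r [Pp uv _] [Pr _ _]].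
exact: g_inj.
Qed.

Lemma stage_trees a : stage a #<= trees (upto a).
Proof.
elim/(well_founded_ind lt_wf): a => a IH; rewrite stageE.
apply: hull_trees; last exact: op_trees.
apply: setU_trees; last first.
  by apply: (@inj_card_le _ _ iota) => [e []//|e f [Se _] [Sf _]]; exact: iota_inj.
apply: bigcup_trees => [|b ba].
  by apply: (@inj_card_le _ _ (@Elt W)) => [b ba|b d _ _ []//]; left.
apply: card_le_trans (IH _ ba) _; apply: subset_card_le; apply: trees_sub.
by move=> d [db|->]; left => //; exact: lt_trans db ba.
Qed.

Lemma before_trees a : before a #<= trees (below a).
Proof.
apply: bigcup_trees => [|b ba].
  by apply: (@inj_card_le _ _ (@Elt W)) => [b ba|b d _ _ []].
apply: card_le_trans (stage_trees b) _; apply: subset_card_le; apply: trees_sub.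
by move=> d [db|->] //; exact: lt_trans db ba.
Qed.

(** A tree mentions only finitely many elements, so some [m] below [a] bounds them all. The given
    [b] serves trees that mention none, and no distinction between limits and successors arises. *)
Lemma trees_bound (a b : W) t : trees (below a) t -> lt b a ->
  exists m, [/\ lt m a, b = m \/ lt b m & trees (upto m) t].
Proof.
elim: t b => [n|w|t1 IH1 t2 IH2] b /=.
- by move=> _ ba; exists b; split=> //; left.
- move=> wa ba; have [wb|wb|bw] := lt_total w b.
  + by exists b; split=> //; [left | left].
  + by exists b; split=> //; [left | right].
  + by exists w; split=> //; [right | right].
- move=> [t1a t2a] /(IH1 _ t1a)[m1 [m1a bm1 t1m1]].
  have [m2 [m2a m12 t2m2]] := IH2 _ t2a m1a.
  exists m2; split=> //; first by case: bm1 m12 => [->|bm1] [<-|m12]; eauto.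
  split=> //; apply: trees_sub t1m1 => d dm1; case: m12 => [<-//|m12].
  by case: dm1 => [dm1|->]; left => //; exact: lt_trans dm1 m12.
Qed.

Lemma stage_le a b : a = b \/ lt a b -> stage a `<=` stage b.
Proof. by move=> [->//|ab] e /(stage_before ab); exact: before_stage. Qed.

Lemma verts_sub (H H' : set E) : H `<=` H' -> verts H `<=` verts H'.
Proof. by move=> HH' u [e /HH' He eu]; exists e. Qed.

Lemma stage_op a u v l e : verts (stage a) u -> verts (stage a) v -> u <> v ->
  (forall f, List.In f l -> stage a f) ->
  (walk (lk (S `\` before a `\` [set e | List.In e l])) u (q (before a) u v l) v /\
       uses (q (before a) u v l) e) \/
      (exists p, [/\ P u v p, trees (upto a) (g u v p) & uses p e]) ->
  stage a e.
Proof.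
move=> [e1 ae1 eu] [e2 ae2 ev] uv la H.
move: ae1 ae2 la; rewrite stageE => ae1 ae2 la.
apply: (@hull_op _ _ _ (e1 :: e2 :: l)).
  by move=> f /= [<-//|[<-//|/la]].
exists u, v; split=> //; split; apply: (@stage_sub a); by rewrite stageE.
Qed.

(** A walk outside [before a] meets a member of [P u v], which therefore is not contained in
    [before a]. Such a family is too large for [before a] and [F] to meet all its members, and a
    member avoiding both is the required walk. *)
Lemma before_conn a u v F : finite_set F ->
  verts (before a) u -> verts (before a) v ->
  conn (lk (S `\` before a)) u v -> conn (lk (S `\` before a `\` F)) u v.
Proof.
move=> Ffin au av [r ur]; have [<-|uv] := pselect (u = v); first exact: conn_refl.
have [b [ba bu bv]] : exists b, [/\ lt b a, verts (stage b) u & verts (stage b) v].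
  case: au => e1 [b1 b1a be1] eu; case: av => e2 [b2 b2a be2] ev.
  have u1 : verts (stage b1) u by exists e1.
  have v2 : verts (stage b2) v by exists e2.
  have [b12|b12|b21] := lt_total b1 b2.
  - by exists b2; split=> //; apply: verts_sub u1; apply: stage_le; right.
  - by exists b2; split=> //; rewrite -b12.
  - by exists b1; split=> //; apply: verts_sub v2; apply: stage_le; right.
have [[Pw Pdis] Pmax] := P_max uv.
have [p Pp pa] : exists2 p, P u v p & ~ uses p `<=` before a.
  have [p [e [Pp pe re]]] := Pmax r (walk_elink ur (fun e re => (uses_elink ur re).1)).
  exists p => // pa; have [_] := uses_elink ur re; apply; exact: pa.
(* Otherwise [p] is indexed over [upto m] for some [m] below [a] and not below [b]; then [stage m]
   has [u] and [v] among its vertices, so closure puts all of [p] into it. *)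
have gpa : ~ trees (below a) (g u v p).
  move=> gpa; have [m [ma bm gpm]] := trees_bound gpa ba.
  apply: pa => e pe; apply: (stage_before ma).
  apply: (@stage_op m u v [::]) => //; try exact: verts_sub (stage_le bm) _ _.
  by right; exists p.
have [|avoid] := pselect (forall p, P u v p -> exists2 e, (before a `|` F) e & uses p e).
  move=> /(edge_disjoint_meet_card Pdis (@subset_refl _ _)) Pa.
  case: (g_min uv Pp gpa); apply: card_le_trans Pa _.
  apply: setU_trees; first exact: before_trees.
  by apply: countable_trees; exact: finite_set_countable.
have [r' Pr' r'a] : exists2 r', P u v r' & forall e, uses r' e -> ~ (before a `|` F) e.
  apply: contrapT => no; apply: avoid => r' Pr'; apply: contrapT => no'.
  by apply: no; exists r' => // e re ae; apply: no'; exists e.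
exists r'; apply: walk_elink (Pw _ Pr').1 _ => e re; have nae := r'a _ re.
by split; [split; [exact: uses_elink (Pw _ Pr').1 _ re | move=> ?; apply: nae; left]
          | move=> ?; apply: nae; right].
Qed.

Lemma walk_enter N F u p v : walk (lk (S `\` F)) u p v ->
  conn (lk (S `\` N `\` F)) u v \/
  exists u' v', [/\ verts N u', verts N v', conn (lk (S `\` N `\` F)) u u' &
    conn (lk (S `\` N `\` F)) v' v].
Proof.
elim: p u => [|[e w] p IH] u /=; first by move=> ->; left; exact: conn_refl.
move=> [[[Se nFe] ee] /IH{}IH]; have [Ne|nNe] := pselect (N e).
  have Nu : verts N u by exists e => //; rewrite ee; left.
  have Nw : verts N w by exists e => //; rewrite ee; right.
  right; case: IH => [wv|[u' [v' [_ Nv' _ v'v]]]].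
    by exists u, w; split=> //; exact: conn_refl.
  by exists u, v'; split=> //; exact: conn_refl.
have uw : conn (lk (S `\` N `\` F)) u w by exact: (@conn_step _ _ _ e).
case: IH => [wv|[u' [v' [Nu' Nv' wu' v'v]]]]; first by left; exact: conn_trans wv.
by right; exists u', v'; split=> //; exact: conn_trans wu'.
Qed.

(* A walk avoiding [F] that meets [before a] does so first in [u'] and last in
   [v'].  As these are joined outside [before a], the family [P u' v'] was not
   exhausted by [before a], hence it is larger than [before a] and [F]. *)
Lemma before_cut a u v F : finite_set F ->
  conn (lk (S `\` before a)) u v -> conn (lk (S `\` F)) u v ->
  conn (lk (S `\` before a `\` F)) u v.
Proof.
move=> Ffin uv [p /(@walk_enter (before a))[//|]].
move=> [u' [v' [au' av' uu' v'v]]].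
have sub : S `\` before a `\` F `<=` S `\` before a by move=> e [].
apply: (conn_trans uu') (conn_trans _ v'v); apply: before_conn => //.
apply: conn_trans (conn_trans uv _).
  by apply: conn_elink_sym; exact: conn_elink_sub sub uu'.
by apply: conn_elink_sym; exact: conn_elink_sub sub v'v.
Qed.

Definition layer (a : W) : set E := stage a `\` before a.

Lemma layer_conn a u v F : finite_set F ->
  verts (stage a) u -> verts (stage a) v ->
  conn (lk (S `\` before a `\` F)) u v -> conn (lk (layer a `\` F)) u v.
Proof.
move=> Ffin au av uv; have [<-|nuv] := pselect (u = v); first exact: conn_refl.
(* Closure speaks only of lists inside the stage, so [F] is cut down to [stage a]. The walk obtained
   lies in [stage a] and thus avoids the rest of [F] too. *)
have [|l lP] := @finite_set_list _ (F `&` stage a); first exact: finite_setIl.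
have /qP qw : conn (lk (S `\` before a `\` [set e | List.In e l])) u v.
  by apply: conn_elink_sub uv => e [Se nFe]; split=> // /lP[].
exists (q (before a) u v l); apply: (walk_elink qw) => e qe.
have [[Se nae] nle] := uses_elink qw qe.
have ae : stage a e by apply: (@stage_op a u v l) => //; [move=> f /lP[] | left].
by split=> // Fe; apply: nle; apply/lP.
Qed.

Lemma layer_two_ended a : two_ended ends (layer a).
Proof. by move=> e [/stage_sub/S_ends]. Qed.

Lemma layer_uniq a b e : layer a e -> layer b e -> a = b.
Proof.
move=> [ae nae] [be nbe]; have [ab|//|ba] := lt_total a b.
  by case: nbe; exact: stage_before ae.
by case: nae; exact: stage_before be.
Qed.

Lemma layer_exists e : ~ countable S -> S e -> exists2 a, lt a c & layer a e.
Proof.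
move=> Sunc Se.
(* If nothing were below [c], then [S] would be indexed by [trees set0], which is countable. *)
have [b bc] : exists b, lt b c.
  apply: contrapT => nb; apply: Sunc; apply: card_le_trans (@trees0_countable W).
  apply: (@inj_card_le _ _ iota) => [f Sf|]; last exact: iota_inj.
  by apply: trees_sub (iotaP Sf) => d dc; apply: nb; exists d.
have [m [mc _ em]] := trees_bound (iotaP Se) bc.
have sm : stage m e by rewrite stageE; apply: hull_sub; right.
have [a [ac ae] amin] := @strict_well_order_min _ lt
  [set a | lt a c /\ stage a e] m lt_wf (conj mc sm).
exists a => //; split=> // -[d da de]; apply: (amin d) => //.
by split=> //; exact: lt_trans da ac.
Qed.

(** The edge set of the connected component of [e] in the layer containing it. *)
Definition piece (e : E) : set E := [set e' | exists a,
  [/\ layer a e, layer a e' &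
      forall u v, ends e u -> ends e' v -> conn (lk (layer a)) u v]].

Lemma piece_sub_layer a e : layer a e -> piece e `<=` layer a.
Proof. by move=> ae e' [b [be be' _]]; rewrite (layer_uniq ae be). Qed.

Lemma piece_sym e e' : piece e e' -> piece e' e.
Proof.
move=> [a [ae ae' ee']]; exists a; split=> // u v eu ev.
by apply: conn_elink_sym; exact: ee'.
Qed.

Lemma piece_trans e e' e'' : piece e e' -> piece e' e'' -> piece e e''.
Proof.
move=> [a [ae ae' ee']] [b [be' be'' ee'']]; have ab := layer_uniq ae' be'; subst b.
exists a; split=> // u v eu ev.
have [w ew] := ends_nonempty (@layer_two_ended a) ae'.
by apply: conn_trans (ee' _ _ eu ew) (ee'' _ _ ew ev).
Qed.

Lemma piece_refl a e : layer a e -> piece e e.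
Proof.
move=> ae; exists a; split=> // u v eu ev.
exact: (ends_conn (@layer_two_ended a) ae).
Qed.

Lemma piece_partition : ~ countable S -> edge_partition S piece.
Proof.
move=> Sunc e Se; have [a ac ae] := layer_exists Sunc Se; split.
- exact: piece_refl ae.
- by move=> e' /(piece_sub_layer ae)[/stage_sub].
- move=> e' ee'; apply/seteqP; split=> f; first exact: piece_trans ee'.
  by apply: piece_trans; exact: piece_sym.
Qed.

Lemma piece_small e : ~ countable S -> S e ->
  exists2 a, lt a c & piece e #<= trees (below a).
Proof.
move=> Sunc Se; have [a ac ae] := layer_exists Sunc Se; exists a => //.
apply: card_le_trans (trees_setU1 _ a).
apply: card_le_trans (stage_trees a); apply: subset_card_le.
by move=> e' /(piece_sub_layer ae)[].
Qed.

Lemma piece_walk a e F u p v : layer a e -> verts (piece e) u ->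
  walk (lk (layer a `\` F)) u p v -> walk (lk (piece e `\` F)) u p v.
Proof.
move=> ae; elim: p u => [|[f w] p IH] u //= pu [[[af nFf] ff] wv].
have pf : piece e f.
  case: pu => e' ee' e'u; apply: (piece_trans ee').
  have ae' := piece_sub_layer ae ee'.
  exists a; split=> // b d e'b fd.
  apply: conn_trans (ends_conn (@layer_two_ended a) ae' e'b e'u) _.
  by apply: (ends_conn (@layer_two_ended a) af) => //; rewrite ff; left.
split=> //; apply: IH => //.
by exists f => //; rewrite ff; right.
Qed.

(** The connection avoiding [F] is first moved outside [before a], then by closure into the layer,
    where it cannot leave the component. *)
Lemma piece_faithful e : ~ countable S -> S e -> cut_faithful ends S (piece e).
Proof.
move=> Sunc Se F Ffin u v pu pv uvF.
have [a _ ae] := layer_exists Sunc Se.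
have sa : piece e `<=` stage a by move=> f /(piece_sub_layer ae)[].
have uv : conn (lk (layer a)) u v.
  case: pu pv => e1 [b [be be1 c1]] e1u [e2 [d [de de2 c2]] e2v].
  have ab := layer_uniq ae be; have ad := layer_uniq ae de; subst b d.
  have [w ew] := ends_nonempty (@layer_two_ended a) ae.
  by apply: conn_trans (conn_elink_sym (c1 _ _ ew e1u)) (c2 _ _ ew e2v).
have [p up] : conn (lk (layer a `\` F)) u v.
  apply: layer_conn => //; try exact: verts_sub sa _ _.
  apply: before_cut => //; apply: conn_elink_sub uv => f [af naf].
  by split=> //; exact: stage_sub af.
by exists p; exact: piece_walk up.
Qed.

Lemma small_pieces : ~ countable S -> exists h, edge_partition S h /\
  forall e, S e -> (exists2 a, lt a c & h e #<= trees (below a)) /\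
    cut_faithful ends S (h e).
Proof.
move=> Sunc; exists piece; split; first exact: piece_partition.
by move=> e Se; split; [exact: piece_small | exact: piece_faithful].
Qed.

End Filtration.

(** * Iterating the decomposition down to countable pieces *)

Lemma family_index (T W : Type) (lt : W -> W -> Prop) (P : set T) (c : W) :
  strict_well_order lt -> P #<= trees (below lt c) ->
  exists g : T -> tree W,
    (forall p r, P p -> P r -> g p = g r -> p = r) /\
    (forall a p, P p -> ~ trees (below lt a) (g p) ->
      ~ (P #<= trees (below lt a))).
Proof.
move=> [wf ltt tot] Pc.
(* With [d] least such that [P] fits into [trees (below lt d)], an [a] whose trees could hold [P] is
   not below [d], so its trees contain all indices. *)
have [d Pd dmin] := @strict_well_order_min _ lt
  [set d | P #<= trees (below lt d)] c wf Pc.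
have [g [gd ginj]] := card_le_inj (Leaf W 0) Pd.
exists g; split=> // a p Pp npa /dmin nad; apply: npa.
apply: trees_sub (gd _ Pp) => b bd.
have [da|<-//|//] := tot d a.
exact: ltt bd da.
Qed.

(** Induction on [c] takes the place of induction on the cardinality: the pieces of an uncountable
    [S] are indexed over smaller elements, and cut-faithfulness is transitive. *)
Lemma decomposition_below (V E W : Type) (ends : E -> set V)
    (lt : W -> W -> Prop) (c : W) (S : set E) :
  strict_well_order lt -> two_ended ends S -> S #<= trees (below lt c) ->
  exists h, edge_partition S h /\
    forall e, S e -> countable (h e) /\ cut_faithful ends S (h e).
Proof.
move=> wo; have [wf _ _] := wo.
elim/(well_founded_ind wf): c S => c IH S Sends Sc.
have [Sct|Sunc] := pselect (countable S).
  by exists (fun=> S); split=> [e Se|e Se]; split.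
have [iota [iotaP iota_inj]] := card_le_inj (Leaf W 0) Sc.
have /choice[P PP] : forall uv : V * V, exists P,
    uv.1 <> uv.2 -> maximal_family (elink ends S) uv.1 uv.2 P.
  move=> [u v]; have [uv|/= uv] := pselect (u = v); first by exists set0.
  by have [P PP] := maximal_family_exists (elink ends S) uv; exists P.
have /choice[g gP] : forall uv : V * V, exists g : seq (E * V) -> tree W,
    uv.1 <> uv.2 -> (forall p r, P uv p -> P uv r -> g p = g r -> p = r) /\
    (forall a p, P uv p -> ~ trees (below lt a) (g p) ->
      ~ (P uv #<= trees (below lt a))).
  move=> uv; have [uv12|nuv] := pselect (uv.1 = uv.2); first by exists (fun=> Leaf W 0).
  have [[Ppath Pdis] _] := PP _ nuv.
  have [|g gP] := @family_index _ _ lt (P uv) c wo; last by exists g.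
  apply: card_le_trans Sc; apply: (edge_disjoint_meet_card Pdis) => // p.
  move=> /Ppath[]; case: p => [/= /nuv//|[e w] p /= [[Se _] _] _].
  by exists e => //; left.
have /choice[q qP] : forall x : set E * V * V * seq E, exists p,
    conn (elink ends (S `\` x.1.1.1 `\` [set e | List.In e x.2])) x.1.1.2 x.1.2 ->
    walk (elink ends (S `\` x.1.1.1 `\` [set e | List.In e x.2])) x.1.1.2 p x.1.2.
  move=> x; have [[p xp]|nx] := pselect (conn
    (elink ends (S `\` x.1.1.1 `\` [set e | List.In e x.2])) x.1.1.2 x.1.2).
    by exists p.
  by exists [::].
have Pmax u v : u <> v -> maximal_family (elink ends S) u v (P (u, v)).
  exact: (PP (u, v)).
have ginj u v : u <> v -> forall p r, P (u, v) p -> P (u, v) r ->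
    g (u, v) p = g (u, v) r -> p = r.
  by move=> uv; exact: (gP (u, v) uv).1.
have gmin u v : u <> v -> forall a p, P (u, v) p ->
    ~ trees (below lt a) (g (u, v) p) -> ~ (P (u, v) #<= trees (below lt a)).
  by move=> uv; exact: (gP (u, v) uv).2.
have qw N u v l : conn (elink ends (S `\` N `\` [set e | List.In e l])) u v ->
    walk (elink ends (S `\` N `\` [set e | List.In e l])) u (q (N, u, v, l)) v.
  exact: (qP (N, u, v, l)).
have [h0 [h0part h0P]] :=
  small_pieces wo Sends iotaP iota_inj Pmax ginj gmin qw Sunc.
(* The refinement is chosen for each piece as a set, so that all edges of one piece share it. *)
have /choice[k kP] : forall H : set E, exists k, two_ended ends H ->
    (exists2 a, lt a c & H #<= trees (below lt a)) -> edge_partition H k /\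
    forall e, H e -> countable (k e) /\ cut_faithful ends H (k e).
  move=> H; have [[Hends [a ac Ha]]|no] := pselect (two_ended ends H /\
      exists2 a, lt a c & H #<= trees (below lt a)).
    by have [k kP] := IH _ ac _ Hends Ha; exists k.
  by exists (fun=> H) => Hends Ha; case: no.
have {}kP e : S e -> edge_partition (h0 e) (k (h0 e)) /\ forall f, h0 e f ->
    countable (k (h0 e) f) /\ cut_faithful ends (h0 e) (k (h0 e) f).
  move=> Se; apply: kP (h0P _ Se).1 => f fe.
  by have [_ h0S _] := h0part _ Se; exact: Sends (h0S _ fe).
exists (fun e => k (h0 e) e); split=> e Se.
  have [ee eS e'e] := h0part _ Se; have [kpart _] := kP _ Se.
  have [kee ke kee'] := kpart _ ee; split=> //.
    exact: subset_trans ke eS.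
  by move=> e' ke'; rewrite (e'e _ (ke _ ke')) kee'.
have [ee eS e'e] := h0part _ Se; have [kpart kcf] := kP _ Se.
have [kee ke kee'] := kpart _ ee; have [kc kf] := kcf _ ee; split=> // F Ffin u v ku kv uv.
apply: kf => //; apply: (h0P _ Se).2 => //.
  by case: ku => f /ke; exists f.
by case: kv => f /ke; exists f.
Qed.

(** The added top [None] has all of [T] below it, so any set of elements of [T] can be indexed over
    [below None]. *)
Lemma strict_well_order_top (T : Type) (lt : T -> T -> Prop) :
  strict_well_order lt ->
  strict_well_order (fun a b : option T => match a, b with
    | Some x, Some y => lt x y | Some _, None => True | None, _ => False end).
Proof.
set lt' := fun _ => _; move=> [wf ltt tot].
have accS x : Acc lt' (Some x).
  by elim/(well_founded_ind wf): x => x IH; constructor => -[y|//] /IH.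
split.
- by move=> [x|]; [exact: accS | constructor => -[y|//] _; exact: accS].
- by move=> [x|] [y|] [z|] //=; exact: ltt.
- move=> [x|] [y|] /=; [|by constructor 1|by constructor 3|by constructor 2].
  by have [xy|->|yx] := tot x y; [constructor 1|constructor 2|constructor 3].
Qed.

Lemma countable_decomposition (V E : Type) (ends : E -> set V) (S : set E) :
  two_ended ends S -> exists h, edge_partition S h /\
    forall e, S e -> countable (h e) /\ cut_faithful ends S (h e).
Proof.
move=> Sends; have [lt /strict_well_order_top wo] := strict_well_order_exists E.
apply: (decomposition_below (c := None) wo Sends).
by apply: (@inj_card_le _ _ (fun e => Elt (Some e))) => // e f _ _ [].
Qed.

(** * From cuts within the pieces to a cut of the whole graph *)

Section Separation.
Variables (V E : Type) (ends : E -> set V) (S : set E) (h : E -> set E).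
Hypothesis h_part : edge_partition S h.
Hypothesis h_faithful : forall e, S e -> cut_faithful ends S (h e).

Local Notation lk := (elink ends).
Local Notation verts := (everts ends).

Lemma walk_first H e x p y : walk (lk S) x p y -> uses p e -> H e ->
  exists2 v, verts H v & conn (lk (S `\` H)) x v.
Proof.
elim: p x => [|[f w] p IH] x //= [[Sf ff] wp] pe He.
have [Hf|nHf] := pselect (H f).
  by exists x; [exists f => //; rewrite ff; left | exact: conn_refl].
case: pe => [/= fe|pe]; first by rewrite fe in nHf.
have [v Hv wv] := IH _ wp pe He; exists v => //; apply: conn_trans wv.
exact: (@conn_step _ _ _ f).
Qed.

Lemma walk_last H e x p y : walk (lk S) x p y -> uses p e -> H e ->
  exists2 v, verts H v & conn (lk (S `\` H)) y v.
Proof.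
elim: p x e => [|[f w] p IH] x e //= [[Sf ff] wp] pe He.
have [[e' pe' He']|no] := pselect (exists2 e', uses p e' & H e').
  exact: IH wp pe' He'.
case: pe => [/= fe|pe]; last by case: no; exists e.
exists w; first by exists f; [rewrite fe | rewrite ff; right].
apply: conn_elink_sym; exists p; apply: (walk_elink wp) => e' pe'.
by split; [exact: uses_elink wp _ pe' | move=> He'; apply: no; exists e'].
Qed.

(* [X] restricted to [H], extended to all vertices along the walks that do not
   use [H]; the cut of [X] is the disjoint sum of the cuts of the [side X H],
   [H] ranging over the pieces, so that some piece separates [x] from [y]. *)
Definition side (X : set V) (H : set E) : set V :=
  [set w | exists2 u, X u /\ verts H u & conn (lk (S `\` H)) w u].

Lemma piece_separates X x p y k : walk (lk S) x p y -> X x -> ~ X y ->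
  (forall e u v, uses p e -> verts (h e) u -> verts (h e) v -> X u -> ~ X v ->
    exists F, [/\ F `<=` h e, F #<= `I_k & ~ conn (lk (h e `\` F)) u v]) ->
  exists F, F #<= `I_k /\ ~ conn (lk (S `\` F)) x y.
Proof.
move=> xpy Xx nXy sep; have pS := uses_elink xpy.
have sepS e u v : uses p e -> verts (h e) u -> verts (h e) v -> X u -> ~ X v ->
    exists F, [/\ F `<=` h e, F #<= `I_k & ~ conn (lk (S `\` F)) u v].
  move=> pe eu ev Xu nXv; have [F [Fe Fk nuv]] := sep _ _ _ pe eu ev Xu nXv.
  exists F; split=> // uv; apply: nuv; apply: h_faithful uv => //; first exact: pS.
  exact: card_le_finite Fk (finite_II _).
have sub H F : F `<=` H -> S `\` H `<=` S `\` F.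
  by move=> FH e [Se nHe]; split=> // /FH.
(* Two vertices of the piece on different sides of [X] cannot be joined outside the piece, since a
   subset [F] of it separates them in all of [S]. *)
have side_on e w : uses p e -> verts (h e) w -> side X (h e) w <-> X w.
  move=> pe ew; split=> [[u [Xu eu] wu]|Xw]; last by exists w => //; exact: conn_refl.
  apply: contrapT => nXw; have [F [Fe _ nuw]] := sepS _ _ _ pe eu ew Xu nXw.
  by apply: nuw; apply: conn_elink_sym; apply: conn_elink_sub wu; exact: sub.
have side_off H f a b : ~ H f -> lk S f a b -> side X H a <-> side X H b.
  move=> nHf [Sf ff]; have ab : conn (lk (S `\` H)) a b by exact: (@conn_step _ _ _ f).
  by split=> -[u Xu wu]; exists u => //; apply: conn_trans wu => //; exact: conn_elink_sym.
pose l : seq {classic set E} := undup (map h (map fst p) : seq {classic set E}).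
have lP H : H \in l -> exists2 e, uses p e & H = h e.
  rewrite mem_undup => /(@InP {classic set E}); rewrite List.in_map_iff.
  by move=> [e [<- pe]]; exists e.
have hl e : uses p e -> (h e : {classic set E}) \in l.
  by move=> pe; rewrite mem_undup; apply/(@InP {classic set E}); exact: List.in_map.
(* Along an edge [f] of [p], membership in [X] and in [side X (h f)] change together and no other
   side in [l] changes. So this parity is constant on [p], and as [X] distinguishes [x] from [y],
   some side does. *)
pose par w := `[< X w >] (+) \big[addb/false]_(H <- l) `[< side X H w >].
have par_step f a b : uses p f -> lk S f a b -> par a = par b.
  move=> pf fab; have [Sf ff] := fab; have [hf _ hff'] := h_part Sf.
  rewrite /par !(bigD1_seq (h f : {classic set E})) ?undup_uniq ?hl //=.
  rewrite (asbool_equiv_eq (side_on f a pf _)); last by exists f => //; rewrite ff; left.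
  rewrite (asbool_equiv_eq (side_on f b pf _)); last by exists f => //; rewrite ff; right.
  rewrite !addbA !addbb; congr (_ (+) _).
  rewrite big_seq_cond [RHS]big_seq_cond; apply: eq_bigr => H /andP[/lP[e pe ->] nef].
  apply: asbool_equiv_eq; apply: side_off fab => ef.
  have [_ _ he] := h_part (pS _ pe).
  by case/negP: nef; apply/eqP; rewrite (he _ ef).
have parxy : par x = par y.
  have : forall r z, uses r `<=` uses p -> walk (lk S) z r y -> par z = par y.
    elim=> [|[f w] r IH] z rp /=; first by move=> ->.
    move=> [zw wr]; rewrite (par_step f z w) //; last by apply: rp; left.
    by apply: IH wr => e re; apply: rp; right.
  by apply; eauto.
have [e pe exy] : exists2 e, uses p e & ~ (side X (h e) x <-> side X (h e) y).
  apply: contrapT => no; move: parxy; rewrite /par (asboolT Xx) (asboolF nXy).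
  have -> : \big[addb/false]_(H <- l) `[< side X H x >] =
            \big[addb/false]_(H <- l) `[< side X H y >]; last by case: (\big[_/_]_(_ <- _) _).
  rewrite big_seq [RHS]big_seq; apply: eq_bigr => H /lP[e pe ->].
  by apply: asbool_equiv_eq; apply: contrapT => exy; apply: no; exists e.
have [he _ _] := h_part (pS _ pe).
have [v1 v1e xv1] := walk_first xpy pe he.
have [v2 v2e yv2] := walk_last xpy pe he.
(* Whichever of [x] and [y] is on the side is joined outside the piece to some [u] in [X]; the other
   is joined to [v2] or [v1], which is not in [X]. The cut [F] lies in the piece, so these
   connections survive it. *)
have [[u [Xu eu] xu]|nsx] := pselect (side X (h e) x).
  have nsy : ~ side X (h e) y by move=> sy; apply: exy; split=> // _; exists u.
  have nXv2 : ~ X v2 by move=> Xv2; apply: nsy; exists v2.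
  have [F [Fe Fk nuv]] := sepS _ _ _ pe eu v2e Xu nXv2.
  exists F; split=> // xy; apply: nuv.
  apply: conn_trans (conn_elink_sym (conn_elink_sub (sub _ _ Fe) xu)) _.
  exact: conn_trans xy (conn_elink_sub (sub _ _ Fe) yv2).
have [u [Xu eu] yu] : side X (h e) y.
  by apply: contrapT => nsy; apply: exy; split.
have nXv1 : ~ X v1 by move=> Xv1; apply: nsx; exists v1.
have [F [Fe Fk nuv]] := sepS _ _ _ pe eu v1e Xu nXv1.
exists F; split=> // xy; apply: nuv.
apply: conn_trans (conn_elink_sym (conn_elink_sub (sub _ _ Fe) yu)) _.
exact: conn_trans (conn_elink_sym xy) (conn_elink_sub (sub _ _ Fe) xv1).
Qed.

End Separation.

(** * Gluing the orientations of the pieces *)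

Lemma bigcup_countable_card I T K (Q : set I) (R : set K) (B : I -> set T) :
  infinite_set R -> Q #<= R -> (forall i, Q i -> countable (B i)) ->
  \bigcup_(i in Q) B i #<= R.
Proof.
move=> Rinf QR Bc; apply: card_le_trans (card_leX_nat Rinf).
have [k0 _] : R !=set0.
  by apply/set0P/negP => /eqP R0; apply: Rinf; rewrite R0.
have [f [fR finj]] := card_le_inj k0 QR.
have /choice[g ginj] : forall i, exists g : T -> nat, Q i ->
    forall t u, B i t -> B i u -> g t = g u -> t = u.
  move=> i; have [Qi|nQi] := pselect (Q i); last by exists (fun=> 0).
  by have [g [_ gP]] := card_le_inj 0 (Bc _ Qi); exists g.
have /choice[k kP] : forall t, exists r, (\bigcup_(i in Q) B i) t ->
    exists i, [/\ Q i, B i t & r = (f i, g i t)].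
  move=> t; have [[i Qi Bi]|nt] := pselect ((\bigcup_(i in Q) B i) t).
    by exists (f i, g i t) => _; exists i.
  by exists (k0, 0).
apply: (@inj_card_le _ _ k) => [t /kP[i [Qi Bi ->]]|t u /kP[i [Qi Bi ->]]].
  by split=> //=; exact: fR.
move=> /kP[j [Qj Bj ->]] [/(finj _ _ Qi Qj) ij]; subst j.
exact: ginj.
Qed.

Section EdgeSubgraph.
Variables (V E : Type) (G : graph V E).

Lemma edges_two_ended : two_ended (ends G) (edges G).
Proof. by move=> e Ge; have [u [v [_ _ _ ->]]] := endsP Ge; exists u, v. Qed.

Lemma link_ends e u v u' v' : link G e u v -> link G e u' v' ->
  (u' = u /\ v' = v) \/ (u' = v /\ v' = u).
Proof.
move=> [Ge +] [_ +]; have [a [b [_ _ ab ->]]] := endsP Ge; move=> e1 e2.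
have ua : [set a; b] u by rewrite e1; left.
have va : [set a; b] v by rewrite e1; right.
have ua' : [set a; b] u' by rewrite e2; left.
have va' : [set a; b] v' by rewrite e2; right.
have aa : [set u; v] a by rewrite -e1; left.
have bb : [set u; v] b by rewrite -e1; right.
have aa' : [set u'; v'] a by rewrite -e2; left.
have bb' : [set u'; v'] b by rewrite -e2; right.
by move: ua va ua' va' aa bb aa' bb' => /= [] ? [] ? [] ? [] ? [] ? [] ? [] ? [] ?;
  subst; auto; congruence.
Qed.

Variable H : set E.
Hypothesis HG : H `<=` edges G.

Lemma edge_subgraph_endsP e : H e -> exists u v,
  [/\ everts (ends G) H u, everts (ends G) H v, u <> v & ends G e = [set u; v]].
Proof.
move=> He; have [u [v [_ _ uv ee]]] := endsP (HG He); exists u, v.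
by split=> //; exists e => //; rewrite ee; [left | right].
Qed.

(** Its vertices are only the ends of [H], so that a countable [H] gives a countable graph. *)
Definition edge_subgraph : graph V E := Graph edge_subgraph_endsP.

Lemma edge_subgraphP : subgraph edge_subgraph G.
Proof.
split=> // u [e He]; have [a [b [Ga Gb _ ->]]] := endsP (HG He).
by case=> ->.
Qed.

Lemma edge_subgraph_countable : countable H -> countable_graph edge_subgraph.
Proof.
move=> Hc; split=> //=.
have -> : everts (ends G) H = \bigcup_(e in H) ends G e.
  by apply/seteqP; split=> u [e He eu]; exists e.
apply: bigcup_countable => // e He.
have [a [b [_ _ _ ->]]] := endsP (HG He).
by apply: finite_set_countable; exact: finite_set2.
Qed.

End EdgeSubgraph.

Section GluedOrientation.
Variables (V E : Type) (G : graph V E) (h : E -> set E).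
Variable o_ : set E -> step V E.
Hypothesis h_part : edge_partition (edges G) h.
Hypothesis h_countable : forall e, edges G e -> countable (h e).
Hypothesis h_faithful : forall e, edges G e ->
  cut_faithful (ends G) (edges G) (h e).
Hypothesis o_wb : forall e (hG : h e `<=` edges G), edges G e ->
  orientation (edge_subgraph hG) (o_ (h e)) /\
  well_balanced (edge_subgraph hG) (o_ (h e)).

Definition glued : step V E := fun e u v => edges G e /\ o_ (h e) e u v.

Lemma glued_orientation : orientation G glued.
Proof.
split=> e u v.
  move=> [Ge ou]; have [_ hG _] := h_part Ge.
  by have [[/(_ _ _ _ ou)[]]] := o_wb hG Ge.
move=> [Ge ee]; have [hee hG _] := h_part Ge.
have [[_ /(_ e u v)]] := o_wb hG Ge.
by move=> /(_ (conj hee ee)) o_or _; rewrite /glued; tauto.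
Qed.

Lemma glued_ends e u v u' v' : glued e u v -> glued e u' v' ->
  (u' = u /\ v' = v) \/ (u' = v /\ v' = u).
Proof.
by move=> /(proj1 glued_orientation) l1 /(proj1 glued_orientation); exact: link_ends.
Qed.

(** Directed [u]-[v] paths in the piece must leave [X] through [D], so at most [m] of them are
    edge-disjoint. Well-balancedness of the piece bounds the undirected number by [m.*2.+1], where
    the extra one makes up for rounding down, and Menger's theorem yields the cut. *)
Lemma piece_cut (X : set V) (D : set E) m e u v : edges G e ->
  (forall f a b, glued f a b -> X a -> ~ D f -> X b) -> D `&` h e #<= `I_m ->
  everts (ends G) (h e) u -> everts (ends G) (h e) v -> X u -> ~ X v ->
  exists F, [/\ F `<=` h e, F #<= `I_(m.*2.+1) &
    ~ conn (elink (ends G) (h e `\` F)) u v].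
Proof.
move=> Ge XD Dm eu ev Xu nXv; have [hee hG hee'] := h_part Ge.
have [[o_link _] wb] := o_wb hG Ge.
have uv : u <> v by move=> uv; rewrite uv in Xu.
have [[opath odis] _] := lambdaP (o_ (h e)) uv.
have om : lambda (o_ (h e)) u v #<= `I_m.
  apply: card_le_trans Dm; apply: (edge_disjoint_meet_card odis) => // p /opath[up _].
  have [f [a [b [pf oab Xa nXb]]]] := walk_leaves up Xu nXv.
  have [/= hef _] := o_link _ _ _ oab.
  exists f => //; split=> //; apply: contrapT => nDf; apply: nXb.
  by apply: XD Xa nDf; split; [exact: (hG _ hef) | rewrite hee'; eauto].
have ofin : finite_set (lambda (o_ (h e)) u v) by exact: card_le_finite om (finite_II _).
have [wbfin wbinf] := wb u v eu ev uv.
have [n ln] : finite_set (lambda (link (edge_subgraph hG)) u v).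
  apply: contrapT => linf; apply: (linf).
  exact: card_le_finite (wbinf linf) ofin.
have nm : n <= m.*2.+1.
  have : n./2 <= m.
    by rewrite -card_le_II; exact: card_le_trans (wbfin _ ln) om.
  by have := odd_double_half n; lia.
have [|C [Cn nuv]] := menger (@link_ends _ _ (edge_subgraph hG)) uv
  (n := m.*2.+1).
  by rewrite (card_le_eql ln) card_le_II.
exists (C `&` h e); split=> [f []//||].
  by apply: card_le_trans Cn; apply: subset_card_le => f [].
move=> uvC; apply: nuv; apply: conn_mono uvC => f a b [[hef nCf] ff]; split=> //.
by move=> Cf; apply: nCf.
Qed.

(** The bound on [D] is required only within the pieces met by the one walk [p], so [D] may be
    infinite. *)
Lemma lambda_le_cut (D : set E) m x p y : x <> y -> walk (link G) x p y ->
  ~ conn (fun e u v => glued e u v /\ ~ D e) x y ->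
  (forall e, uses p e -> D `&` h e #<= `I_m) ->
  lambda (link G) x y #<= `I_(m.*2.+1).
Proof.
move=> xy xpy nxy pD.
pose X := [set w | conn (fun e u v => glued e u v /\ ~ D e) x w].
have Xx : X x by exact: conn_refl.
have XD f a b : glued f a b -> X a -> ~ D f -> X b.
  move=> gab xa nDf; apply: (conn_trans xa).
  exact: (@conn_step _ _ _ f).
have [|F [Fm nF]] := piece_separates h_part h_faithful xpy Xx nxy (k := m.*2.+1).
  move=> e u v pe; apply: piece_cut XD (pD _ pe).
  by have [a [b []]] := walk_uses xpy pe.
apply: card_le_trans Fm; have [[lpath ldis] _] := lambdaP (link G) xy.
apply: (edge_disjoint_meet_card ldis) => // q /lpath[xq _].
apply: contrapT => no; apply: nF; exists q; apply: walk_elink (xq) _ => e qe.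
split; first by have [a [b []]] := walk_uses xq qe.
by move=> Fe; apply: no; exists e.
Qed.

Lemma lambda_le_finite x y m : x <> y -> lambda glued x y #<= `I_m ->
  lambda (link G) x y #<= `I_(m.*2.+1).
Proof.
move=> xy lm; have [D [Dm nxy]] := menger glued_ends xy lm.
have [[p xpy]|no] := pselect (conn (link G) x y).
  apply: (lambda_le_cut xy xpy nxy) => e _.
  by apply: card_le_trans Dm; apply: subset_card_le => f [].
have [[lpath _] _] := lambdaP (link G) xy.
suff -> : lambda (link G) x y = set0 by exact: card_ge0.
by apply/seteqP; split=> // p /lpath[xp _]; apply: no; exists p.
Qed.

Lemma lambda_le_infinite x y : x <> y -> infinite_set (lambda (link G) x y) ->
  infinite_set (lambda glued x y) -> lambda (link G) x y #<= lambda glued x y.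
Proof.
move=> xy linf oinf.
have [P [[Ppath Pdis] Pmax]] := maximal_family_exists glued xy.
have Plam : P #<= lambda glued x y by apply: (lambdaP glued xy).2.
have PG p f : P p -> uses p f -> edges G f.
  by move=> /Ppath[xp _] pf; have [a [b []]] := walk_uses xp pf.
(* All pieces met by a maximal directed family: [D] still meets every directed path, and
   countability of the pieces keeps it no larger than the infinite [lambda glued x y]. *)
pose D := \bigcup_(p in P) \bigcup_(f in uses p) h f.
have Dlam : D #<= lambda glued x y.
  apply: bigcup_countable_card => // p Pp; apply: bigcup_countable => [|f pf].
    apply: finite_set_countable.
    exact: card_le_finite (list_card_le (l := map fst p) _) (finite_II _).
  by apply: h_countable; exact: PG pf.
apply: contrapT => nle.
have [[lpath ldis] _] := lambdaP (link G) xy.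
have [p lp pD] : exists2 p, lambda (link G) x y p & forall e, uses p e -> ~ D e.
  apply: contrapT => no; apply: nle; apply: card_le_trans Dlam.
  apply: (edge_disjoint_meet_card ldis) => // p lp; apply: contrapT => nD.
  by apply: no; exists p => // e pe De; apply: nD; exists e.
have [xp _] := lpath _ lp.
have Ge e : uses p e -> edges G e by move=> pe; have [a [b []]] := walk_uses xp pe.
apply: linf; apply: card_le_finite (finite_II 1).
(* [D] is a union of pieces, so every piece met by the path [p] avoiding [D] is disjoint from it:
   [m = 0], which leaves at most one edge-disjoint path. *)
apply: (@lambda_le_cut D 0 x p y) => //.
  move=> [r xr]; have [|q [f [Pq qf rf]]] := Pmax r.
    by apply: walk_mono xr => e a b _ [].
  have [a [b [_]]] := walk_uses xr rf; apply.
  exists q => //; exists f => //.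
  by have [] := h_part (PG _ _ Pq qf).
move=> e pe; suff -> : D `&` h e = set0 by exact: card_ge0.
apply/seteqP; split=> // f [[q Pq [f' qf' hf'f]] hef].
have [hee _ hee'] := h_part (Ge _ pe).
have [_ _ hf'] := h_part (PG _ _ Pq qf').
apply: (pD _ pe); exists q => //; exists f' => //.
by rewrite -(hf' _ hf'f) (hee' _ hef).
Qed.

Lemma glued_well_balanced : well_balanced G glued.
Proof.
move=> x y _ _ xy.
have [[m om]|oinf] := pselect (finite_set (lambda glued x y)); last first.
  split=> [n _|linf]; last exact: lambda_le_infinite.
  move/infiniteP: oinf; apply: card_le_trans.
  by apply: subset_card_le.
have lm : lambda (link G) x y #<= `I_(m.*2.+1).
  by apply: lambda_le_finite => //; rewrite (card_le_eql om).
split=> [n ln|linf].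
  rewrite (card_le_eqr om) card_le_II.
  move: lm; rewrite (card_le_eql ln) card_le_II.
  by have := odd_double_half n; lia.
by case: linf; exact: card_le_finite lm (finite_II _).
Qed.

End GluedOrientation.

Theorem theorem1p2 (A : forall V E : Type, graph V E -> Prop)
  (A_subgraph : forall (V E : Type) (H G : graph V E),
    subgraph H G -> A V E G -> A V E H)
  (A_countable : forall (V E : Type) (G : graph V E),
    A V E G -> countable_graph G -> has_well_balanced_orientation G) :
  forall (V E : Type) (G : graph V E),
    A V E G -> has_well_balanced_orientation G.
Proof.
move=> V E G AG.
have [h [h_part hP]] := countable_decomposition (@edges_two_ended _ _ G).
(* The orientation is chosen per edge set, so edges of one piece agree on it. Since [edge_subgraph]
   depends on the inclusion proof, proof irrelevance transfers the choice to every such proof. *)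
have /choice[o_ o_P] : forall H : set E, exists o : step V E,
    forall HG : H `<=` edges G, countable H ->
    orientation (edge_subgraph HG) o /\ well_balanced (edge_subgraph HG) o.
  move=> H; have [[HG Hc]|no] := pselect (H `<=` edges G /\ countable H); last first.
    by exists (fun _ _ _ => False) => HG Hc; case: no.
  have [||o oP] := A_countable _ _ (edge_subgraph HG).
  - exact: A_subgraph (edge_subgraphP HG) AG.
  - exact: edge_subgraph_countable.
  - by exists o => HG' _; rewrite (Prop_irrelevance HG' HG).
have o_wb e (hG : h e `<=` edges G) : edges G e ->
    orientation (edge_subgraph hG) (o_ (h e)) /\
    well_balanced (edge_subgraph hG) (o_ (h e)).
  by move=> Ge; apply: o_P; exact: (hP _ Ge).1.
exists (glued G h o_); split.
  exact: glued_orientation.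
apply: glued_well_balanced => // e Ge; first exact: (hP _ Ge).1.
exact: (hP _ Ge).2.
Qed.
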